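(* For any $1<s\le\frac32$ and any $z\in\mathbb{D}$, we have $$\sup_{N\in\mathbb{N}}\mathbb{E}_{\mathbb{P}_{K_{\mathbb{D}}}}\Big(\sup_{f\in A^2(\mathbb{D}):\|f\|\le1}\Big|\sum_{k=0}^Ng_X^{(k)}(s,z;f)\Big|^2\Big)=\infty.$$
   Context: $\mathbb{D}$ is the open unit disk in $\mathbb{C}$, $dA$ is Lebesgue measure on $\mathbb{D}$ normalized so that $A(\mathbb{D})=1$, and $K_{\mathbb{D}}(z,w)=(1-z\bar w)^{-2}$ is the Bergman kernel. $A^2(\mathbb{D})$ is the space of holomorphic $f:\mathbb{D}\to\mathbb{C}$ with $\|f\|^2=\int_{\mathbb{D}}|f|^2dA<\infty$. $\mathrm{Conf}(\mathbb{D})$ is the space of (locally finite) configurations $X$ on $\mathbb{D}$, and $\mathbb{P}_{K_{\mathbb{D}}}$ is the determinantal point process induced by $K_{\mathbb{D}}$: the unique simple point process (Borel probability measure on $\mathrm{Conf}(\mathbb{D})$) whose $n$-th correlation function with respect to $dA$ is $\det(K_{\mathbb{D}}(x_i,x_j))_{1\le i,j\le n}$ for all $n\ge1$. The Poincaré metric is $d_{\mathbb{D}}(x,z)=\log\frac{1+|\varphi_x(z)|}{1-|\varphi_x(z)|}$ with $\varphi_x(z)=\frac{z-x}{1-\bar x z}$. For $k\in\mathbb{N}=\{0,1,2,\dots\}$, $z\in\mathbb{D}$: $\mathbb{A}_k(z)=\{x\in\mathbb{D}:k\le d_{\mathbb{D}}(z,x)<k+1\}$ and $g_X^{(k)}(s,z;f)=\sum_{x\in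 X\cap\mathbb{A}_k(z)}e^{-s d_{\mathbb{D}}(z,x)}f(x)$. *)

(* Defs.v *)
From HB Require Import structures.
From mathcomp Require Import all_boot all_order all_algebra.
From mathcomp Require Import complex.
From mathcomp Require Import all_classical all_reals all_analysis.
From mathcomp Require Import measurable_realfun.

Set Implicit Arguments.
Unset Strict Implicit.
Unset Printing Implicit Defensive.

Import Order.TTheory GRing.Theory Num.Theory.
Import numFieldNormedType.Exports.
Import ComplexField.Normc.

Local Open Scope classical_set_scope.
Local Open Scope ring_scope.
Local Open Scope complex_scope.

(* R[i] does not inherit the topology that MathComp-Analysis puts on K^o for
   every numFieldType K; the library does the same copy for R : realType. *)
HB.instance Definition _ (R : realType) := NormedModule.copy R[i] R[i]^o.

Section borel_complex.
Variable R : realType.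

Local Notation borel := (<<s @open R[i] >> : set (set R[i])).

Fact borelC A : borel A -> borel (~` A).
Proof. by move=> mA; rewrite -setTD; exact: sigma_algebraCD. Qed.

HB.instance Definition _ := @isMeasurable.Build (sigma_display (@open R[i]))
  R[i] borel (@sigma_algebra0 _ setT _) borelC (@sigma_algebra_bigcup _ setT _).

Definition complex_of_pair (p : R * R) : R[i] := p.1 +i* p.2.

Lemma open_complex_of_pair (U : set R[i]) :
  open U -> measurable (complex_of_pair @^-1` U).
Proof.
move=> oU.
pose rect (q : rat * rat * rat * rat) : set (R * R) :=
  `]ratr q.1.1.1, ratr q.1.1.2[%classic `*` `]ratr q.1.2, ratr q.2[%classic.
pose F q := if `[< rect q `<=` complex_of_pair @^-1` U >] then rect q else set0.
have -> : complex_of_pair @^-1` U = \bigcup_q F q.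
  apply/seteqP; split => [[x y] /= Uxy|p [q _]]; last first.
    by rewrite /F; case: asboolP => // + qp; exact.
  have /nbhs_ballP[e /= e0 eU] : nbhs (x +i* y) U by exact: open_nbhs_nbhs.
  case: e e0 eU => a b; rewrite ltcE /= => /andP[/eqP -> a0] eU.
  have a20 : 0 < a / 2 by rewrite divr_gt0.
  have lo (t : R) : t - a / 2 < t by rewrite ltrBlDr ltrDl.
  have hi (t : R) : t < t + a / 2 by rewrite ltrDl.
  have [q1 /[!in_itv]/= /andP[q1l q1r]] := rat_in_itvoo (lo x).
  have [q2 /[!in_itv]/= /andP[q2l q2r]] := rat_in_itvoo (hi x).
  have [q3 /[!in_itv]/= /andP[q3l q3r]] := rat_in_itvoo (lo y).
  have [q4 /[!in_itv]/= /andP[q4l q4r]] := rat_in_itvoo (hi y).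
  exists (q1, q2, q3, q4) => //; rewrite /F; case: asboolP => [_|[]].
    by split => /=; rewrite in_itv /= ?q1r ?q2l ?q3r ?q4l.
  move=> [u v] [] /=; rewrite !in_itv /= => /andP[u1 u2] /andP[v1 v2].
  apply: eU; rewrite -ball_normE /ball_ /= /complex_of_pair /=.
  have -> : x +i* y - (u +i* v) = (x - u)%:C + 'i * (y - v)%:C.
    by simpc.
  apply: (le_lt_trans (ler_normD _ _)).
  rewrite normrM !normc_def /= !expr0n /= !expr1n !addr0 add0r sqrtr1 !sqrtr_sqr.
  have dx : `|x - u| < a / 2.
    rewrite ltr_norml ltrBrDr; apply/andP; split; last first.
      by rewrite ltrBlDr -ltrBlDl (lt_trans q1l).
    by rewrite addrC ltrBlDr (lt_trans u2).
  have dy : `|y - v| < a / 2.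
    rewrite ltr_norml ltrBrDr; apply/andP; split; last first.
      by rewrite ltrBlDr -ltrBlDl (lt_trans q3l).
    by rewrite addrC ltrBlDr (lt_trans v2).
  by rewrite mul1r -rmorphD /= ltcR (splitr a) ltrD.
apply: countable_bigcupT_measurable => // q; rewrite /F; case: ifPn => // _.
by apply: measurableX; exact: measurable_itv.
Qed.

Lemma measurable_complex_of_pair : measurable_fun setT complex_of_pair.
Proof.
apply: (@measurability _ _ _ _ _ _ (@open R[i])) => // _ [U oU <-].
by rewrite setTI; exact: open_complex_of_pair.
Qed.

HB.instance Definition _ := @isMeasurableFun.Build _ _ _ _ complex_of_pair
  measurable_complex_of_pair.

End borel_complex.

Section bergman.
Variable R : realType.
Local Notation C := R[i].

Definition disk : set C := [set z | `|z| < 1].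

Fact pi_inv_ge0 : 0 <= (@pi R)^-1.
Proof. by rewrite invr_ge0 pi_ge0. Qed.

Definition planar_lebesgue : set C -> \bar R :=
  pushforward (lebesgue_measure \x lebesgue_measure)%E (@complex_of_pair R).

Fact planar0 : planar_lebesgue set0 = 0%E.
Proof. by rewrite /planar_lebesgue /pushforward preimage_set0 measure0. Qed.

Fact planar_ge0 A : (0 <= planar_lebesgue A)%E.
Proof. exact: measure_ge0 (lebesgue_measure \x lebesgue_measure)%E _. Qed.

Fact planar_sigma_additive : semi_sigma_additive planar_lebesgue.
Proof.
apply: (@measure_semi_sigma_additive _ _ _ (pushforward _ _)).
exact: measurable_complex_of_pair.
Qed.

HB.instance Definition _ := isMeasure.Build _ _ _ planar_lebesgue
  planar0 planar_ge0 planar_sigma_additive.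

(* dA is the restriction of area to the disk: all integrals against area below
   are taken over the disk. *)
Definition area : {measure set C -> \bar R} :=
  mscale (NngNum pi_inv_ge0) planar_lebesgue.

Definition bergman_kernel (z w : C) : C := ((1 - z * w^*%C) ^+ 2)^-1.

(* Functions on the disk are represented by total functions C -> C whose values
   outside the disk are irrelevant.  [derivable f z 1] over the field C is
   complex differentiability at z. *)
Definition holomorphic_on_disk (f : C -> C) : Prop :=
  forall z, disk z -> derivable f z 1.

Definition bergman_sqnorm (f : C -> C) : \bar R :=
  \int[area]_(z in disk) ((normc (f z)) ^+ 2)%:E.

Definition bergman_space : set (C -> C) :=
  [set f | holomorphic_on_disk f /\ (bergman_sqnorm f < +oo)%E].

Definition bergman_norm (f : C -> C) : R := Num.sqrt (fine (bergman_sqnorm f)).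

Definition moebius (x z : C) : C := (z - x) / (1 - x^*%C * z).

Definition poincare_dist (x z : C) : R :=
  ln ((1 + normc (moebius x z)) / (1 - normc (moebius x z))).

Definition annulus (k : nat) (z : C) : set C :=
  [set x | disk x /\ k%:R <= poincare_dist z x < k.+1%:R].

End bergman.

Arguments disk : clear implicits.
Arguments area : clear implicits.

Section configurations.
Variable R : realType.
Local Notation C := R[i].

(* Configurations without multiplicities: a simple point process on the disk is
   a probability measure on the locally finite subsets of the disk. *)
Record configuration := Configuration {
  points : set C ;
  points_disk : points `<=` disk R ;
  points_locally_finite : forall K : set C,
    compact K -> K `<=` disk R -> finite_set (points `&` K) }.

Fact empty_disk : (set0 : set C) `<=` disk R.
Proof. exact: sub0set. Qed.

Fact empty_locally_finite (K : set C) : compact K -> K `<=` disk R ->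
  finite_set (set0 `&` K).
Proof. by move=> _ _; rewrite set0I. Qed.

HB.instance Definition _ := gen_eqMixin configuration.
HB.instance Definition _ := gen_choiceMixin configuration.
HB.instance Definition _ := isPointed.Build configuration
  (Configuration empty_disk empty_locally_finite).

Definition counting_events : set (set configuration) :=
  [set E | exists (B : set C) (n : nat), [/\ measurable B, B `<=` disk R &
    E = [set X | (points X `&` B #= `I_n)%card]]].

(* The Borel sigma-algebra of the space of configurations is the one generated
   by the counting maps X |-> #(X n B), B Borel. *)
Definition Conf := g_sigma_algebraType counting_events.

(* Integral over disk^n against the n-fold product of dA, as an iterated
   integral; it is only applied to nonnegative measurable functions. *)
Fixpoint integral_disk_tuple (n : nat) : (n.-tuple C -> \bar R) -> \bar R :=
  match n with
  | 0 => fun F => F [tuple]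
  | m.+1 => fun F => (\int[area R]_(z in disk R)
      integral_disk_tuple (fun t : m.-tuple C => F [tuple of z :: t]))%E
  end.

Definition distinct_points (X : Conf) (n : nat) : set (n.-tuple C) :=
  [set t : n.-tuple C | uniq t /\ forall i, points X (tnth t i)].

Arguments distinct_points : clear implicits.

Definition correlation_function (P : probability Conf R) (n : nat)
    (rho : n.-tuple C -> \bar R) : Prop :=
  forall phi : n.-tuple C -> \bar R,
    measurable_fun setT phi -> (forall t, 0 <= phi t)%E ->
    (\int[P]_X (\esum_(t in distinct_points X n) phi t) =
     integral_disk_tuple (fun t => phi t * rho t))%E.

(* K is Hermitian, so that the determinant is a real number. *)
Definition determinantal (K : C -> C -> C) (P : probability Conf R) : Prop :=
  forall n : nat, (0 < n)%N ->
    correlation_function P (fun t : n.-tuple C =>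
      (complex.Re (\det (\matrix_(i, j) K (tnth t i) (tnth t j))))%:E).

(* The set points X n annulus k z is finite, its closure being compact in the
   disk, so the finitely supported sum below is the sum over all its points. *)
Definition weighted_sum (X : Conf) (k : nat) (s : R) (z : C) (f : C -> C) : C :=
  \sum_(x \in points X `&` annulus k z) (expR (- s * poincare_dist z x))%:C * f x.

End configurations.

(* Main.v *)
Require Import Defs.
From HB Require Import structures.
From mathcomp Require Import all_boot all_order all_algebra.
From mathcomp Require Import complex finmap.
From mathcomp Require Import all_classical all_reals all_analysis.
From mathcomp Require Import measurable_realfun.
From mathcomp Require Import ring lra.

(** Fix a configuration X and N, and let L f be the sum over the points x of X
    of w(x) f(x), where w(x) = exp(-s d(z, x)) if d(z, x) < N + 1 and w(x) = 0
    otherwise. Testing L on a multiple of the polynomial with coefficients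
    (n + 1) conj(L z^n), for n < M, bounds the inner supremum from below by
    T_M = sum_(n < M) (n + 1) |L z^n|^2 ([sup_ge_power_sums]).

    The real and imaginary parts of L z^n are linear statistics of X. For a
    determinantal process whose kernel K satisfies Bessel's inequality
    int |K(x, y)|^2 dA(y) <= K(x, x), the second moment of a linear statistic
    sum_(x in X) u(x) is at least one half of the double integral of
    (u(x) - u(y))^2 |K(x, y)|^2 ([variance_lower_bound]). Summing over n and
    letting M grow, the expectation in the theorem is at least one half of the
    double integral of || w(x) K_x - w(y) K_y ||^2 |K(x, y)|^2, the norm being
    that of A^2.

    This norm is at least the distance of w(x) K_x to the line spanned by K_y,
    whose square is w(x)^2 (K(x, x) - |K(x, y)|^2 / K(y, y))
    ([energy_sum_lim_ge]). When y runs over a suitable Euclidean square near x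
    with side comparable to 1 - |x|^2, this is comparable to w(x)^2 K(x, x), and
    |K(x, y)| is comparable to K(x, x) ([local_energy_ge]); the square has area
    comparable to 1 / K(x, x). Hence the expectation is at least a constant
    times the integral of w(x)^2 K(x, x)^2. Since exp(-d(z, x)) is comparable
    to 1 - |x|^2 and 2 s <= 3, the integrand is at least a constant times
    1 / (1 - |x|^2) on the ball d(z, x) < N + 1. As N grows the bound tends to
    a multiple of the integral of 1 / (1 - |x|^2) over the disk, which is the
    harmonic series ([harmonic_le_integral]).

    The facts on A^2 that are used, namely the norm of a polynomial and Bessel's
    inequality, rest on the orthogonality of the monomials, which follows from
    the invariance of area under rotations, and on the mean 1 / (n + 1) of
    |z|^(2 n). The correlation functions are tested on nonnegative functions
    only, so the second moments are computed with nonnegative terms, moving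
    what is negative to the other side of each identity. *)

Set Implicit Arguments.
Unset Strict Implicit.
Unset Printing Implicit Defensive.

Import Order.TTheory GRing.Theory Num.Theory.
Import numFieldNormedType.Exports.
Import ComplexField.Normc.

Local Open Scope classical_set_scope.
Local Open Scope ring_scope.
Local Open Scope complex_scope.

(** * Complex numbers as a measurable space *)

Section complex_basics.
Variable R : realType.
Local Notation C := R[i].
Local Notation Re := (@complex.Re R).
Local Notation Im := (@complex.Im R).

Lemma normc_sqr (z : C) : normc z ^+ 2 = Re z ^+ 2 + Im z ^+ 2.
Proof. by case: z => a b; rewrite /= sqr_sqrtr// addr_ge0// sqr_ge0. Qed.

Lemma normc_ge0 (z : C) : 0 <= normc z.
Proof. by case: z => a b; exact: sqrtr_ge0. Qed.

Lemma norm_normc (z : C) : `|z| = (normc z)%:C.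
Proof. by case: z. Qed.

Lemma diskE (z : C) : disk R z <-> normc z ^+ 2 < 1.
Proof.
by rewrite /disk /= norm_normc ltcR expr_lt1// normc_ge0.
Qed.

Lemma normc_lt1 (z : C) : disk R z -> normc z < 1.
Proof. by rewrite /disk /= norm_normc ltcR. Qed.

Lemma ler_Re_normc (z : C) : `|Re z| <= normc z.
Proof. by have := normc_ge_Re z; rewrite norm_normc lecR. Qed.

Lemma ler_Im_normc (z : C) : `|Im z| <= normc z.
Proof.
rewrite -[leLHS]ger0_norm// -[leRHS]ger0_norm ?normc_ge0//.
by rewrite -ler_sqr ?nnegrE ?normr_ge0// !real_normK ?num_real// normc_sqr lerDr sqr_ge0.
Qed.

Lemma continuous_Re : continuous (Re : C -> R).
Proof.
move=> x A /nbhs_ballP[e /= e0 eA]; apply/nbhs_ballP.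
exists e%:C => /=; first by rewrite ltcR.
move=> y; rewrite -ball_normE /ball_ /= norm_normc ltcR => xy; apply: eA.
rewrite -ball_normE /=; apply: le_lt_trans xy.
by have := ler_Re_normc (x - y); case: x y => [a b] [c d].
Qed.

Lemma continuous_Im : continuous (Im : C -> R).
Proof.
move=> x A /nbhs_ballP[e /= e0 eA]; apply/nbhs_ballP.
exists e%:C => /=; first by rewrite ltcR.
move=> y; rewrite -ball_normE /ball_ /= norm_normc ltcR => xy; apply: eA.
rewrite -ball_normE /=; apply: le_lt_trans xy.
by have := ler_Im_normc (x - y); case: x y => [a b] [c d].
Qed.

Lemma measurable_Re : measurable_fun setT (Re : C -> R).
Proof.
apply: (measurability _ (RGenOpens.measurableE R)) => _ [_ [a [b ->] <-]].
rewrite setTI; apply: sub_sigma_algebra.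
by move/continuousP : continuous_Re; apply; exact: interval_open.
Qed.

Lemma measurable_Im : measurable_fun setT (Im : C -> R).
Proof.
apply: (measurability _ (RGenOpens.measurableE R)) => _ [_ [a [b ->] <-]].
rewrite setTI; apply: sub_sigma_algebra.
by move/continuousP : continuous_Im; apply; exact: interval_open.
Qed.

End complex_basics.

Section complex_meas.
Variable R : realType.
Local Notation C := R[i].
Local Notation Re := (@complex.Re R).
Local Notation Im := (@complex.Im R).

Section meas.
Context d (T : measurableType d).
Implicit Types f g : T -> C.

Lemma measurable_complexP f : measurable_fun setT (fun t => Re (f t)) ->
  measurable_fun setT (fun t => Im (f t)) -> measurable_fun setT f.
Proof.
move=> mr mi.
have -> : f = @complex_of_pair R \o (fun t => (Re (f t), Im (f t))).
  by apply/funext => t /=; rewrite /complex_of_pair; case: (f t).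
apply: measurableT_comp; first exact: measurable_complex_of_pair.
exact/measurable_fun_pairP.
Qed.

Lemma measurable_fun_Re f : measurable_fun setT f ->
  measurable_fun setT (fun t => Re (f t)).
Proof. by move=> mf; apply: measurableT_comp (@measurable_Re R) mf. Qed.

Lemma measurable_fun_Im f : measurable_fun setT f ->
  measurable_fun setT (fun t => Im (f t)).
Proof. by move=> mf; apply: measurableT_comp (@measurable_Im R) mf. Qed.

End meas.

Lemma continuous_complex_of_pair : continuous (@complex_of_pair R).
Proof.
move=> [x y] A /nbhs_ballP[[a b] /=].
rewrite ltcE /= => /andP[/eqP -> a0] eA.
apply/nbhs_ballP; exists (a / 2); first by rewrite /= divr_gt0.
move=> [u v] [/= xu yv]; apply: eA; move: xu yv.
rewrite -!ball_normE /ball_ /= /complex_of_pair /= => xu yv.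
rewrite norm_normc ltcR; apply: le_lt_trans (_ : `|x - u| + `|y - v| < a).
  rewrite -(@ler_pXn2r _ 2) ?nnegrE ?normc_ge0 ?addr_ge0// normc_sqr /=.
  rewrite (sqrrD `|x - u|) !real_normK ?num_real//.
  by rewrite addrAC lerDl mulrn_wge0// mulr_ge0.
by rewrite (splitr a) ltrD.
Qed.

(** Configurations are finite on compact subsets of the disk, so this makes
    the sums over the points of a ball finite. *)
Lemma compact_cball (r : R) : compact [set z : C | normc z ^+ 2 <= r].
Proof.
pose K := [set p : R * R | p.1 ^+ 2 + p.2 ^+ 2 <= r].
have -> : [set z : C | normc z ^+ 2 <= r] = @complex_of_pair R @` K.
  apply/seteqP; split => [z|_ [p Kp <-]];
    last by rewrite /= -/(normc _) sqr_sqrtr ?addr_ge0 ?sqr_ge0.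
  rewrite /= normc_sqr => zr; exists (Re z, Im z) => //; by case: z {zr}.
apply: continuous_compact.
  by apply: continuous_subspaceT; exact: continuous_complex_of_pair.
pose s := 1 + `|r|.
apply: (@subclosed_compact _ _ (`[-s, s] `*` `[-s, s])).
- have -> : K = (fun p : R * R => p.1 ^+ 2 + p.2 ^+ 2) @^-1` [set x | x <= r] by [].
  apply: preimage_closed; last exact: closed_le.
  move=> p _; apply: cvgD.
    by apply: (cvg_comp fst (fun x : R => x ^+ 2));
      [exact: cvg_fst|exact: exprn_continuous].
  by apply: (cvg_comp snd (fun x : R => x ^+ 2));
    [exact: cvg_snd|exact: exprn_continuous].
- by apply: compact_setX; exact: segment_compact.
- have lem (t : R) : t ^+ 2 <= r -> -s <= t <= s.
    move=> tr; rewrite -ler_norml -ler_sqr ?nnegrE// /s ?addr_ge0//.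
    rewrite real_normK ?num_real//; apply: (le_trans tr).
    apply: (le_trans (ler_norm r)); rewrite sqrrD expr1n mul1r.
    rewrite -addrA; have := sqr_ge0 `|r|; have := normr_ge0 r; lra.
  move=> p pr.
  by split; rewrite /= in_itv /=; apply: lem; apply: le_trans pr;
    rewrite ?lerDl ?lerDr sqr_ge0.
Qed.

Lemma measurable_inv : measurable_fun setT (fun x : R => x^-1).
Proof.
rewrite -(setvU [set 0 : R]); apply/measurable_funU => //.
  exact: measurableC.
split; last first.
  exact: measurable_fun_set1.
apply: open_continuous_measurable_fun.
  by apply: closed_openC; exact: closed_eq.
by move=> x; rewrite inE /= => /eqP x0; exact: inv_continuous.
Qed.

Section meas2.
Context d (T : measurableType d).
Implicit Types f g : T -> C.

Lemma measurable_funV (f : T -> R) : measurable_fun setT f ->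
  measurable_fun setT (fun t => (f t)^-1).
Proof. by move=> mf; apply: measurableT_comp measurable_inv mf. Qed.

Lemma measurable_funCD f g : measurable_fun setT f -> measurable_fun setT g ->
  measurable_fun setT (fun t => f t + g t).
Proof.
move=> mf mg; apply: measurable_complexP.
  apply: (@eq_measurable_fun _ _ _ _ setT (fun t => Re (f t) + Re (g t))).
    by move=> t _; case: (f t) (g t) => [a b] [].
  by apply: measurable_funD; exact: measurable_fun_Re.
apply: (@eq_measurable_fun _ _ _ _ setT (fun t => Im (f t) + Im (g t))).
  by move=> t _; case: (f t) (g t) => [a b] [].
by apply: measurable_funD; exact: measurable_fun_Im.
Qed.

Lemma measurable_funCN f : measurable_fun setT f ->
  measurable_fun setT (fun t => - f t).
Proof.
move=> mf; apply: measurable_complexP.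
  apply: (@eq_measurable_fun _ _ _ _ setT (fun t => - Re (f t))).
    by move=> t _; case: (f t).
  by apply: measurableT_comp => //; exact: measurable_fun_Re.
apply: (@eq_measurable_fun _ _ _ _ setT (fun t => - Im (f t))).
  by move=> t _; case: (f t).
by apply: measurableT_comp => //; exact: measurable_fun_Im.
Qed.

Lemma measurable_funCJ f : measurable_fun setT f ->
  measurable_fun setT (fun t => (f t)^*%C).
Proof.
move=> mf; apply: measurable_complexP.
  apply: (@eq_measurable_fun _ _ _ _ setT (fun t => Re (f t))).
    by move=> t _; case: (f t).
  exact: measurable_fun_Re.
apply: (@eq_measurable_fun _ _ _ _ setT (fun t => - Im (f t))).
  by move=> t _; case: (f t).
by apply: measurableT_comp => //; exact: measurable_fun_Im.
Qed.

Lemma measurable_funCM f g : measurable_fun setT f -> measurable_fun setT g ->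
  measurable_fun setT (fun t => f t * g t).
Proof.
move=> mf mg.
have [mrf mif] := (measurable_fun_Re mf, measurable_fun_Im mf).
have [mrg mig] := (measurable_fun_Re mg, measurable_fun_Im mg).
apply: measurable_complexP.
  apply: (@eq_measurable_fun _ _ _ _ setT
      (fun t => Re (f t) * Re (g t) - Im (f t) * Im (g t))).
    by move=> t _; case: (f t) (g t) => [a b] [].
  by apply: measurable_funB; exact: measurable_funM.
apply: (@eq_measurable_fun _ _ _ _ setT
    (fun t => Re (f t) * Im (g t) + Im (f t) * Re (g t))).
  by move=> t _; case: (f t) (g t) => [a b] [].
by apply: measurable_funD; exact: measurable_funM.
Qed.

Lemma measurable_funCX f n : measurable_fun setT f ->
  measurable_fun setT (fun t => f t ^+ n).
Proof.
move=> mf; elim: n => [|n ih]; first exact: measurable_cst.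
by under eq_fun do rewrite exprS; exact: measurable_funCM.
Qed.

Lemma measurable_normc f : measurable_fun setT f ->
  measurable_fun setT (fun t => normc (f t)).
Proof.
move=> mf.
apply: (@eq_measurable_fun _ _ _ _ setT
    (fun t => Num.sqrt (Re (f t) ^+ 2 + Im (f t) ^+ 2))).
  by move=> t _; case: (f t).
apply: measurableT_comp; first by apply: continuous_measurable_fun;
  exact: sqrt_continuous.
by apply: measurable_funD; apply: measurable_funX;
  [exact: measurable_fun_Re|exact: measurable_fun_Im].
Qed.

End meas2.

Lemma measurable_disk : measurable (disk R).
Proof.
have -> : disk R = (fun z : C => normc z) @^-1` `]-oo, 1[.
  by apply/seteqP; split => z; rewrite /disk /= norm_normc ltcR in_itv.
rewrite -[X in measurable X]setTI; by apply: (measurable_normc (@measurable_id _ C setT)).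
Qed.

End complex_meas.

(** * Area on the disk *)

Section semicircle.
Variable R : realType.
Local Notation lam := (@lebesgue_measure R).

(** The substitution x = r sin t turns the integrand into 2 r^2 (cos t)^2,
    which is the derivative of r^2 (t + sin t cos t). *)
Lemma integral_semicircle (r : R) : 0 < r ->
  (\int[lam]_(x in `[(- r)%R, r%R]) (2 * Num.sqrt (r ^+ 2 - x ^+ 2))%:E =
    (pi * r ^+ 2)%:E)%E.
Proof.
move=> r0; pose F (t : R) : R := r * sin t.
have pi2 : - (pi / 2) < pi / 2 :> R by have := pi_gt0 R; lra.
have dF (t : R) : is_derive t 1 F (r * cos t).
  by rewrite /F; apply: is_deriveZ.
have dF1 : derive1 F = (fun t => r * cos t).
  by apply/funext => t; rewrite derive1E; apply: derive_val.
have cF (t : R) : {for t, continuous F}.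
  by apply/differentiable_continuous/derivable1_diffP; apply: ex_derive.
have c' (t : R) : {for t, continuous (fun t => r * cos t)}.
  by apply: cvgM; [exact: cvg_cst|exact: continuous_cos].
have Fa : F (- (pi / 2)) = - r by rewrite /F sinN sin_pihalf mulrN1.
have Fb : F (pi / 2) = r by rewrite /F sin_pihalf mulr1.
have -> : `[- r, r] = `[F (- (pi / 2)), F (pi / 2)] by rewrite Fa Fb.
rewrite (@integration_by_substitution_increasing R F
   (fun x => 2 * Num.sqrt (r ^+ 2 - x ^+ 2)))//; first last.
- apply: continuous_subspaceT => x.
  apply: cvgM; first exact: cvg_cst.
  apply: (cvg_comp (fun x => r ^+ 2 - x ^+ 2) Num.sqrt); last exact: sqrt_continuous.
  by apply: cvgB; [exact: cvg_cst|exact: exprn_continuous].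
- split.
  + by move=> t _; apply: ex_derive.
  + exact/cvg_at_right_filter/cF.
  + exact/cvg_at_left_filter/cF.
- rewrite dF1; apply/cvg_ex; eexists; exact/cvg_at_left_filter/c'.
- rewrite dF1; apply/cvg_ex; eexists; exact/cvg_at_right_filter/c'.
- by rewrite dF1 => t _; exact: c'.
- by move=> x y xI yI xy; rewrite /F ltr_pM2l// ltr_sin.
- exact: ltW.
rewrite dF1.
transitivity (\int[lam]_(t in `[(- (pi / 2))%R, (pi / 2)%R])
    (2 * r ^+ 2 * cos t ^+ 2)%:E)%E.
  apply: eq_integral.
  move=> t /[!inE] /=; rewrite in_itv/= => tI; congr EFin; rewrite !fctE /F.
  rewrite exprMn sin2cos2 mulrBr mulr1 opprB addrC subrK -exprMn sqrtr_sqr.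
  by rewrite ger0_norm ?mulr_ge0 ?(ltW r0)// ?cos_ge0_pihalf//; ring.
pose H (t : R) : R := r ^+ 2 * (t + sin t * cos t).
have dH (t : R) : is_derive t 1 H (2 * r ^+ 2 * cos t ^+ 2).
  have -> : 2 * r ^+ 2 * cos t ^+ 2 =
     r ^+ 2 *: (1 + (sin t *: (- sin t) + cos t *: cos t)).
    rewrite /GRing.scale /= mulrN -!expr2 sin2cos2; ring.
  by rewrite /H; apply: is_deriveZ.
have ccos : continuous (fun t : R => 2 * r ^+ 2 * cos t ^+ 2 : R).
  move=> t; apply: cvgM; first exact: cvg_cst.
  apply: (cvg_comp cos (fun x : R => x ^+ 2)); first exact: continuous_cos.
  exact: exprn_continuous.
rewrite (@continuous_FTC2 R (fun t : R => 2 * r ^+ 2 * cos t ^+ 2) H)//.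
- by rewrite -EFinB /H cosN sinN cos_pihalf !mulr0 !addr0; congr EFin; field.
- exact: continuous_subspaceT.
- have cH (t : R) : {for t, continuous H}.
    by apply/differentiable_continuous/derivable1_diffP; apply: ex_derive.
  split.
  + by move=> t _; apply: ex_derive.
  + exact/cvg_at_right_filter/cH.
  + exact/cvg_at_left_filter/cH.
- by move=> t _; rewrite derive1E; apply: derive_val.
Qed.

End semicircle.

(** Through this, every integral over the disk becomes an integral over the
    whole plane against one probability measure, [disk_area]. *)
Lemma ge0_integral_mrestr d (T : measurableType d) (R : realType)
    (m : {measure set T -> \bar R}) (D : set T) (mD : measurable D) (f : T -> \bar R) :
  measurable_fun setT f -> (forall x, 0 <= f x)%E ->
  (\int[m]_(x in D) f x = \int[mrestr m mD]_x f x)%E.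
Proof.
move=> mf f0; rewrite -(setvU D) ge0_integral_setU//=; last 3 first.
- exact: measurableC.
- by rewrite setvU.
- by apply/disj_setPS => z [].
rewrite [X in (X + _)%E](_ : _ = 0%E) ?add0e.
  apply: (eq_measure_integral (mrestr m mD)) => A mA AD.
  by rewrite /mrestr; congr (m _); exact/esym/setIidl.
rewrite -(integral_measure_zero (~` D) f).
apply: (eq_measure_integral (@mzero _ T R)) => A mA AD.
transitivity (m set0); last exact: measure0.
by congr (m _); apply/seteqP; split => // z [/AD].
Qed.

Section area.
Variable R : realType.
Local Notation C := R[i].
Local Notation lam := (@lebesgue_measure R).

Lemma integral_area (f : C -> \bar R) : measurable_fun setT f ->
  (forall z, 0 <= f z)%E ->
  (\int[area R]_z f z = (pi^-1)%:E * \int[lam \x lam]_p f (complex_of_pair p))%E.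
Proof.
move=> mf f0; rewrite /area ge0_integral_mscale//=; congr (_ * _)%E.
rewrite ge0_integral_pushforward//=; exact: measurable_complex_of_pair.
Qed.

Lemma xsection_disk (t x : R) :
  xsection (@complex_of_pair R @^-1` [set z | normc z ^+ 2 < t]) x =
  `](- Num.sqrt (t - x ^+ 2)), Num.sqrt (t - x ^+ 2)[%classic.
Proof.
apply/seteqP; split => y; rewrite /xsection /= in_itv /= inE /=
    -/(normc (x +i* y)) -ltr_norml.
  rewrite normc_sqr /= => xyt; rewrite -ltr_sqr ?nnegrE ?sqrtr_ge0//.
  rewrite real_normK ?num_real// sqr_sqrtr; first by rewrite ltrBrDl.
  by rewrite ltW// subr_gt0; apply: le_lt_trans xyt; rewrite lerDl sqr_ge0.
move=> h; have : 0 < Num.sqrt (t - x ^+ 2) by apply: le_lt_trans h.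
rewrite sqrtr_gt0 => tx; rewrite normc_sqr /=.
have : `|y| ^+ 2 < Num.sqrt (t - x ^+ 2) ^+ 2.
  by rewrite ltr_sqr ?nnegrE ?sqrtr_ge0.
by rewrite real_normK ?num_real// sqr_sqrtr ?(ltW tx)// ltrBrDl.
Qed.

(** Slicing by vertical lines gives the semicircle integral. *)
Lemma area_disk (t : R) : 0 < t -> area R [set z | normc z ^+ 2 < t] = t%:E.
Proof.
move=> t0; rewrite /area /mscale /= /planar_lebesgue /pushforward.
transitivity ((pi^-1)%:E * (pi * t)%:E)%E; last first.
  by rewrite -EFinM mulrA mulVf ?mul1r// gt_eqF// pi_gt0.
congr (_ * _)%E.
have st : 0 < Num.sqrt t by rewrite sqrtr_gt0.
rewrite -{2}(sqr_sqrtr (ltW t0)) -integral_semicircle// [RHS]integral_mkcond.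
rewrite /product_measure1; apply: eq_integral => x _.
have lamE : lam (xsection (@complex_of_pair R @^-1` [set z | normc z ^+ 2 < t]) x) =
    (2 * Num.sqrt (t - x ^+ 2))%:E.
  rewrite xsection_disk lebesgue_measure_itv /= lte_fin.
  case: ifPn => h; first by rewrite -EFinB opprK mulr_natl mulr2n.
  have := sqrtr_ge0 (t - x ^+ 2); rewrite le_eqVlt => /orP[/eqP <-|];
    first by rewrite mulr0.
  by move=> s0; case/negP: h; rewrite (lt_trans _ s0)// oppr_lt0.
rewrite patchE [LHS]lamE; case: ifPn; first by rewrite sqr_sqrtr// ltW.
rewrite notin_setE /= in_itv /= -ler_norml -ler_sqr ?nnegrE ?(ltW st)//.
rewrite real_normK ?num_real// sqr_sqrtr ?(ltW t0)// => /negP; rewrite -ltNge => tx.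
by rewrite ler0_sqrtr ?mulr0// subr_le0 ltW.
Qed.

Definition disk_area : set C -> \bar R := mrestr (area R) (@measurable_disk R).
HB.instance Definition _ := Measure.on disk_area.

Lemma disk_area_setT : disk_area setT = 1%E.
Proof.
transitivity (area R [set z | normc z ^+ 2 < 1]); last exact: area_disk.
by rewrite /disk_area /mrestr setTI; congr (area R _); apply/seteqP; split => z /diskE.
Qed.

HB.instance Definition _ := Measure_isProbability.Build _ _ _ disk_area disk_area_setT.

Lemma integral_disk_area (f : C -> \bar R) : measurable_fun setT f ->
  (forall z, 0 <= f z)%E ->
  (\int[area R]_(z in disk R) f z = \int[disk_area]_z f z)%E.
Proof. exact: ge0_integral_mrestr.
Qed.

End area.

(** * Invariance of area under rotations *)

Section rotation.
Variable R : realType.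
Local Notation C := R[i].
Local Notation lam := (@lebesgue_measure R).
Local Notation Re := (@complex.Re R).
Local Notation Im := (@complex.Im R).

Definition translate (a : R) (x : measurableTypeR R) : measurableTypeR R := x + a.

Lemma measurable_translate a : measurable_fun setT (translate a).
Proof. by apply: measurable_funD => //; exact: measurable_cst. Qed.

HB.instance Definition _ a :=
  @isMeasurableFun.Build _ _ _ _ (translate a) (measurable_translate a).

Lemma lebesgue_measure_translate (a : R) (A : set R) : measurable A ->
  pushforward lam (translate a) A = lam A.
Proof.
move=> mA; apply/esym/lebesgue_measure_unique => //= _ [[x y]] _ <-.
rewrite /pushforward [X in _ = lam X](_ : _ = `](x - a), (y - a)]%classic).
  rewrite !lebesgue_measure_itv/= !lte_fin ltrD2r -!EFinB.
  by congr (if _ then _%:E else _); ring.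
by apply/seteqP; split => z; rewrite /translate /= !in_itv /= ltrBlDr lerBrDr.
Qed.

Lemma ge0_integral_translate (a : R) (g : R -> \bar R) : measurable_fun setT g ->
  (forall x, 0 <= g x)%E ->
  (\int[lam]_x g (x + a)%R = \int[lam]_x g x)%E.
Proof.
move=> mg g0.
transitivity (\int[pushforward lam (translate a)]_x g x)%E.
  by rewrite ge0_integral_pushforward//; exact: measurable_translate.
by apply: eq_measure_integral => A mA _; exact: lebesgue_measure_translate.
Qed.

Implicit Types f : R * R -> \bar R.
Local Notation lam2 := (lam \x lam)%E.

(** On each vertical line the shear is a translation. *)
Lemma integral_shear_snd (t : R) f : measurable_fun setT f ->
  (forall p, 0 <= f p)%E ->
  (\int[lam2]_p f (p.1, p.2 + t * p.1)%R = \int[lam2]_p f p)%E.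
Proof.
move=> mf f0; have ms : measurable_fun setT (fun p : R * R => (p.1, p.2 + t * p.1)).
  apply: measurable_fun_pair => //; apply: measurable_funD => //.
  by apply: measurable_funM => //; exact: measurable_cst.
rewrite !fubini_tonelli1//; last exact: (measurableT_comp mf ms).
apply: eq_integral => x _; rewrite /fubini_F /=.
rewrite (ge0_integral_translate (t * x) (g := fun y => f (x, y)))//.
by apply: measurableT_comp mf _; exact: pair1_measurable.
Qed.

Lemma integral_shear_fst (t : R) f : measurable_fun setT f ->
  (forall p, 0 <= f p)%E ->
  (\int[lam2]_p f (p.1 + t * p.2, p.2)%R = \int[lam2]_p f p)%E.
Proof.
move=> mf f0; have ms : measurable_fun setT (fun p : R * R => (p.1 + t * p.2, p.2)).
  apply: measurable_fun_pair => //; apply: measurable_funD => //.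
  by apply: measurable_funM => //; exact: measurable_cst.
rewrite !fubini_tonelli2//; last exact: (measurableT_comp mf ms).
apply: eq_integral => y _; rewrite /fubini_G /=.
rewrite (ge0_integral_translate (t * y) (g := fun x => f (x, y)))//.
by apply: measurableT_comp mf _; exact: pair2_measurable.
Qed.

(** A rotation by an angle a is a product of three shears, with coefficients
    - tan (a / 2), sin a and - tan (a / 2); here tan (a / 2) = (1 - c) / s. *)
Lemma integral_rotation (c s : R) f : c ^+ 2 + s ^+ 2 = 1 -> s != 0 ->
  measurable_fun setT f -> (forall p, 0 <= f p)%E ->
  (\int[lam2]_p f (c * p.1 - s * p.2, s * p.1 + c * p.2)%R = \int[lam2]_p f p)%E.
Proof.
move=> cs s0 mf f0; pose t := (1 - c) / s.
have ts : t * s = 1 - c by rewrite /t mulfVK.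
have tc : t * (1 + c) = s.
  by apply: (mulIf s0); rewrite mulrAC ts -expr2 -(addrK (c ^+ 2) (s ^+ 2)) (addrC (s
    ^+ 2)) cs; ring.
have ms1 u : measurable_fun setT (fun p : R * R => (p.1 + u * p.2, p.2)).
  apply: measurable_fun_pair => //; apply: measurable_funD => //.
  by apply: measurable_funM => //; exact: measurable_cst.
have ms2 u : measurable_fun setT (fun p : R * R => (p.1, p.2 + u * p.1)).
  apply: measurable_fun_pair => //; apply: measurable_funD => //.
  by apply: measurable_funM => //; exact: measurable_cst.
rewrite -[RHS](integral_shear_fst (- t))//.
have mf1 := measurableT_comp mf (ms1 (- t)).
rewrite -[RHS](integral_shear_snd s (f := fun p => f (p.1 + - t * p.2, p.2)))//.
have mf2 := measurableT_comp mf1 (ms2 s).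
rewrite -[RHS](integral_shear_fst (- t)
  (f := fun p => f (p.1 + - t * (p.2 + s * p.1), p.2 + s * p.1)))//.
apply: eq_integral => -[x y] _ /=; congr (f (_, _)).
  transitivity ((1 - t * s) * x - (t + t * (1 - t * s)) * y); last by ring.
  rewrite ts -tc; ring.
transitivity (s * x + (1 - t * s) * y); last by ring.
rewrite ts; ring.
Qed.

Lemma integral_disk_rotation (u : C) (f : C -> \bar R) :
  normc u = 1 -> Im u != 0 -> measurable_fun setT f -> (forall z, 0 <= f z)%E ->
  (\int[@disk_area R]_z f (u * z)%R = \int[@disk_area R]_z f z)%E.
Proof.
move=> u1 u0 mf f0.
have mu : measurable_fun setT (fun z : C => u * z).
  by apply: measurable_funCM => //; exact: measurable_cst.
have mD := @measurable_disk R.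
rewrite -!integral_disk_area//; last exact: (measurableT_comp mf mu).
rewrite integral_mkcond [RHS]integral_mkcond.
have mg : measurable_fun setT (f \_ (disk R)).
  by apply/(measurable_restrict _ mD measurableT); rewrite setTI; exact: measurable_funTS.
have g0 z : (0 <= (f \_ (disk R)) z)%E by rewrite patchE; case: ifPn.
transitivity (\int[area R]_z (f \_ (disk R)) (u * z)%R)%E.
  apply: eq_integral => z _; rewrite !patchE.
  suff -> : (z \in disk R) = (u * z \in disk R) by [].
  by apply/idP/idP; rewrite !inE !diskE normcM u1 mul1r.
rewrite !integral_area//; last exact: (measurableT_comp mg mu).
congr (_ * _)%E.
have cs : Re u ^+ 2 + Im u ^+ 2 = 1 by rewrite -normc_sqr u1 expr1n.
rewrite -[RHS](integral_rotation cs u0)//; last first.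
  by apply: (measurableT_comp mg); exact: measurable_complex_of_pair.
apply: eq_integral => -[x y] _; congr ((f \_ _) _).
rewrite /complex_of_pair /=; case: (u) => a b /=; simpc.
by congr (_ +i* _); ring.
Qed.

End rotation.

(** * Radial moments *)

Section moments.
Variable R : realType.
Local Notation C := R[i].
Local Notation lam := (@lebesgue_measure R).
Local Notation mu := (@disk_area R).

Lemma le_integral_disk (f g : C -> \bar R) :
  measurable_fun setT f -> measurable_fun setT g ->
  (forall z, 0 <= f z)%E -> (forall z, 0 <= g z)%E ->
  (forall z, disk R z -> f z <= g z)%E ->
  (\int[mu]_z f z <= \int[mu]_z g z)%E.
Proof.
move=> mf mg f0 g0 fg; rewrite -!integral_disk_area//.
by apply: ge0_le_integral => //; do ?[exact: measurable_funTS|exact: measurable_disk].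
Qed.

(** The codomain carries its Borel structure explicitly, so that the law of
    [sqn] is recognised as a measure. *)
Definition sqn (z : C) : measurableTypeR R := normc z ^+ 2.

Lemma measurable_sqn : measurable_fun setT sqn.
Proof. exact: (measurable_funX 2 (measurable_normc (@measurable_id _ C setT))). Qed.

HB.instance Definition _ :=
  @isMeasurableFun.Build _ _ _ _ sqn measurable_sqn.

Lemma disk_area_sqn (t : R) : mu [set z | sqn z < t] =
  (if t <= 0 then 0 else if t <= 1 then t else 1)%:E.
Proof.
rewrite /disk_area /mrestr; case: ifPn => [t0|]; last rewrite -ltNge => t0.
  rewrite (_ : _ `&` _ = set0) ?measure0//.
  apply/seteqP; split => // z [/= zt _]; move: (lt_le_trans zt t0).
  by rewrite ltNge sqr_ge0.
case: ifPn => [t1|]; last rewrite -ltNge => t1.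
  transitivity (area R [set z | normc z ^+ 2 < t]); last exact: area_disk.
  congr (area R _); apply/seteqP; split => z; first by case.
  by move=> /= zt; split => //; apply/diskE; apply: lt_le_trans t1.
transitivity (area R [set z | normc z ^+ 2 < 1]); last exact: area_disk.
congr (area R _); apply/seteqP; split => z.
  by move=> [_ /diskE].
by move=> /= z1; split; [exact: lt_trans t1|exact/diskE].
Qed.

(** The law of |z|^2 is uniform on [0, 1]: both measures agree on the half-lines
    by the area of disks. *)
Lemma pushforward_sqn (A : set R) : measurable A ->
  pushforward mu sqn A = lam (A `&` `[0, 1]).
Proof.
move=> mA.
(* Half-lines generate the Borel sets, are stable under intersection, and those
   bounded by integers exhaust the line. *)
pose m2 : {measure set (measurableTypeR R) -> \bar R} :=
  mrestr lam (measurable_itv `[0%R, 1%R]).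
apply: (@measure_unique _ R (measurableTypeR R) (@RGenInftyO.G R)
   (fun n => `]-oo, n%:R[%classic) _ _ _ _ (pushforward mu sqn) m2) => //.
- exact: RGenInftyO.measurableE.
- move=> _ _ [x ->] [y ->]; exists (Num.min x y).
  by apply/seteqP; split => z /=; rewrite !in_itv /= lt_min; [case=> -> ->|case/andP].
- by move=> n; exists n%:R.
- apply/seteqP; split => // x _; exists (Num.truncn `|x|).+1 => //=.
  by rewrite in_itv /= (le_lt_trans (ler_norm _))// truncnS_gt.
- move=> _ [t ->]; rewrite /pushforward /m2 /= /mrestr.
  transitivity (mu [set z | sqn z < t]).
    by congr (disk_area _); apply/seteqP; split => z; rewrite /= in_itv.
  rewrite disk_area_sqn; case: ifPn => [t0|]; last rewrite -ltNge => t0.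
    rewrite (_ : _ `&` _ = set0) ?measure0//.
    apply/seteqP; split => // x []; rewrite /= !in_itv /= => xt /andP[x0 _].
    by move: (lt_le_trans xt t0); rewrite ltNge x0.
  case: ifPn => [t1|]; last rewrite -ltNge => t1.
    rewrite (_ : _ `&` _ = `[0, t[%classic).
      by rewrite lebesgue_measure_itv /= lte_fin t0 -EFinB subr0.
    apply/seteqP; split => x; rewrite /= !in_itv /=.
      by move=> [-> /andP[-> _]].
    by move=> /andP[-> xt]; split => //; rewrite ltW// (lt_le_trans xt).
  rewrite (_ : _ `&` _ = `[0, 1]%classic).
    by rewrite lebesgue_measure_itv /= lte_fin ltr01 -EFinB subr0.
  apply/seteqP; split => x; rewrite /= !in_itv /=; first by case.
  by move=> x01; split => //; case/andP: x01 => _ /le_lt_trans; exact.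
- move=> n; rewrite /pushforward; apply: le_lt_trans (_ : 1%:E < +oo)%E; last exact: ltry.
  apply: probability_le1; rewrite -[X in measurable X]setTI; exact: measurable_sqn.
Qed.

Lemma integral_itv01_expr n :
  (\int[lam]_(t in `[0%R, 1%R]) (t ^+ n)%:E = (n.+1%:R^-1)%:E)%E.
Proof.
pose F (t : R) : R := n.+1%:R^-1 * t ^+ n.+1.
have dF (t : R) : is_derive t 1 F (t ^+ n).
  have -> : t ^+ n = n.+1%:R^-1 *: ((n.+1%:R * t ^+ n) *: 1).
    by rewrite /GRing.scale /= mulr1 mulKf// pnatr_eq0.
  have dX := is_deriveX n.+1 (is_derive_id t (1 : R)).
  have -> : F = n.+1%:R^-1 \*: (@id R ^+ n.+1).
    by apply/funext => x; rewrite /F /= exprfctE.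
  exact: is_deriveZ.
have cF (x : R) : {for x, continuous F}.
  by apply/differentiable_continuous/derivable1_diffP; apply: ex_derive.
rewrite (@continuous_FTC2 R (fun t : R => t ^+ n) F)//.
- by rewrite -EFinB /F expr1n mulr1 expr0n /= mulr0 subr0.
- by apply: continuous_subspaceT; exact: exprn_continuous.
- split.
  + by move=> t _; apply: ex_derive.
  + exact/cvg_at_right_filter/cF.
  + exact/cvg_at_left_filter/cF.
- by move=> t _; rewrite derive1E; apply: derive_val.
Qed.

Lemma ge0_integral_disk_sqn (g : R -> \bar R) : measurable_fun setT g ->
  (forall t, 0 <= g t)%E ->
  (\int[mu]_z g (sqn z) = \int[lam]_(t in `[0%R, 1%R]) g t)%E.
Proof.
move=> mg g0; rewrite (ge0_integral_mrestr lam (measurable_itv `[0%R, 1%R]))//.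
transitivity (\int[pushforward mu sqn]_t g t)%E.
  by rewrite ge0_integral_pushforward//; exact: measurable_sqn.
by apply: eq_measure_integral => A mA _; exact: pushforward_sqn.
Qed.

Lemma integral_disk_sqn n : (\int[mu]_z (sqn z ^+ n)%:E = (n.+1%:R^-1)%:E)%E.
Proof.
rewrite -integral_itv01_expr.
transitivity (\int[lam]_(t in `[0%R, 1%R]) (`|t| ^+ n)%:E)%E.
  rewrite -(ge0_integral_disk_sqn (g := fun t => (`|t| ^+ n)%:E)).
  - by apply: eq_integral => z _; rewrite ger0_norm// sqr_ge0.
  - apply/measurable_EFinP; apply: measurable_funX; exact: normr_measurable.
  - by move=> t; rewrite lee_fin exprn_ge0.
by apply: eq_integral => t; rewrite inE /= in_itv /= => /andP[t0 _]; rewrite ger0_norm.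
Qed.
End moments.

(** * Orthogonality of the monomials *)

Section orthogonality.
Variable R : realType.
Local Notation C := R[i].
Local Notation Re := (@complex.Re R).
Local Notation Im := (@complex.Im R).
Local Notation mu := (@disk_area R).

Lemma Re_sum (I : Type) (r : seq I) (P : pred I) (F : I -> C) :
  Re (\sum_(i <- r | P i) F i) = \sum_(i <- r | P i) Re (F i).
Proof. by apply: (big_morph Re) => // -[a b] [c d]. Qed.

Lemma Im_sum (I : Type) (r : seq I) (P : pred I) (F : I -> C) :
  Im (\sum_(i <- r | P i) F i) = \sum_(i <- r | P i) Im (F i).
Proof. by apply: (big_morph Im) => // -[a b] [c d]. Qed.

Lemma normc_sqrE (w : C) : normc w ^+ 2 = Re (w * w^*%C).
Proof. by rewrite normc_sqr; case: w => a b /=; ring. Qed.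

Lemma normcX (w : C) n : normc (w ^+ n) = normc w ^+ n.
Proof. by elim: n => [|n ih]; rewrite ?expr0 ?normc1// !exprS normcM ih. Qed.

Lemma normc_conj (w : C) : normc w^*%C = normc w.
Proof. by case: w => a b /=; rewrite sqrrN. Qed.

Definition monomial_re (c : C) (n m : nat) (z : C) : R :=
  Re (c * z ^+ n * z^*%C ^+ m).

Lemma measurable_monomial_re c n m : measurable_fun setT (monomial_re c n m).
Proof.
apply: measurable_fun_Re; apply: measurable_funCM.
  by apply: measurable_funCM; [exact: measurable_cst|exact: measurable_funCX].
by apply: measurable_funCX; exact: measurable_funCJ.
Qed.

Lemma ler_monomial_re c n m z : disk R z -> `|monomial_re c n m z| <= normc c.
Proof.
move=> /normc_lt1 z1; apply: (le_trans (ler_Re_normc _)).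
rewrite !normcM !normcX normc_conj -mulrA ler_piMr ?normc_ge0//.
by rewrite -exprD exprn_ile1 ?normc_ge0 ?ltW.
Qed.

Lemma integrable_monomial_re c n m : mu.-integrable setT (EFin \o monomial_re c n m).
Proof.
apply/integrableP; split; first by apply/measurable_EFinP; exact: measurable_monomial_re.
apply: (@le_lt_trans _ _ (\int[mu]_z (normc c)%:E)%E).
  apply: le_integral_disk => //.
  - apply: measurableT_comp => //.
    by apply/measurable_EFinP; exact: measurable_monomial_re.
  - by move=> z; rewrite lee_fin normc_ge0.
  - by move=> z Dz /=; rewrite lee_fin ler_monomial_re.
by rewrite integral_cst//= probability_setT mule1 ltry.
Qed.

(** With k = |n - m|, the rotation by pi / (2 k) multiplies the coefficient c by
    some v with v^2 = -1. Doing it twice changes the sign of the integrand, so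
    its positive and negative parts have the same integral. *)
Lemma integral_monomial_re_neq c n m : n != m ->
  (\int[mu]_z (monomial_re c n m z)%:E = 0)%E.
Proof.
move=> nm.
pose A (d : C) := (\int[mu]_z (Num.max (monomial_re d n m z) 0)%:E)%E.
(* The angle al makes u ^+ k = 'i, hence v ^+ 2 = -1. *)
pose k : nat := (maxn n m - minn n m)%N.
have k0 : (0 < k)%N by rewrite /k /maxn /minn; case: (ltngtP n m) nm => // h _;
  rewrite subn_gt0.
pose al : R := pi / 2 / k%:R.
pose u : C := cos al +i* sin al.
have uX j : u ^+ j = cos (j%:R * al) +i* sin (j%:R * al).
  elim: j => [|j ih]; first by rewrite expr0 mul0r cos0 sin0.
  rewrite exprS ih /u -natr1 mulrDl mul1r addrC cosD sinD; simpc.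
  by congr (_ +i* _); ring.
have kal : k%:R * al = pi / 2 by rewrite /al mulrC divfK// pnatr_eq0 -lt0n.
have uu : u * u^*%C = 1.
  rewrite /u /=; simpc; rewrite -!expr2 cos2Dsin2 mulrC.
  by congr (_ +i* _); rewrite addrC subrr.
have u1 : normc u = 1.
  by apply/eqP; rewrite -(@pexpr_eq1 _ _ 2)// ?normc_ge0// normc_sqrE uu.
pose v := u ^+ n * u^*%C ^+ m.
have ukE : u ^+ k = 'i by rewrite uX kal cos_pihalf sin_pihalf.
have v2 : v ^+ 2 = -1.
  have uJk : u^*%C ^+ k = - 'i.
    by rewrite -(rmorphXn (@conjc R)) ukE /=; simpc.
  have [nm'|mn] := leqP n m.
    have mE : m = (n + k)%N by rewrite /k (maxn_idPr nm') (minn_idPl nm') subnKC.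
    rewrite /v mE exprD mulrA -exprMn uu expr1n mul1r uJk sqrrN sqr_i //.
  have nE : n = (m + k)%N.
    by rewrite /k (maxn_idPl (ltnW mn)) (minn_idPr (ltnW mn)) subnKC// ltnW.
  rewrite /v nE exprD mulrAC -exprMn uu expr1n mul1r ukE sqr_i //.
have sin0 : Im u != 0.
  rewrite /= gt_eqF// sin_gt0_pi// /al; apply/andP; split.
    by rewrite !divr_gt0// ?pi_gt0// ltr0n.
  rewrite ltr_pdivrMr ?ltr0n// (@lt_le_trans _ _ pi)//.
    by rewrite gtr_pMr ?pi_gt0// invf_lt1// ltr1n.
  by rewrite ler_peMr ?pi_ge0// ler1n.
have mA d : measurable_fun setT (fun z => (Num.max (monomial_re d n m z) 0)%:E).
  apply/measurable_EFinP; apply: measurable_maxr.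
    exact: measurable_monomial_re.
  exact: measurable_cst.
have Arot d : A d = A (d * v).
  rewrite /A -(integral_disk_rotation u1 sin0)//.
    apply: eq_integral => z _; congr (Num.max _ _)%:E.
    rewrite /monomial_re; congr Re; rewrite rmorphM /= !exprMn /v; ring.
  by move=> z; rewrite lee_fin le_max lexx orbT.
have AN : A (- c) = A c.
  by rewrite (Arot c) (Arot (c * v)) -mulrA -expr2 v2 mulrN1.
have := integrable_monomial_re c n m => /integrable_pos_fin_num fA.
rewrite integralE; set X := (\int[mu]_z _)%E; set Y := (\int[mu]_z _)%E.
have XA : X = A c.
  by apply: eq_integral => z _; rewrite funeposE /= -EFin_max.
have YA : Y = A (- c).
  apply: eq_integral => z _; rewrite funenegE /= -EFin_max.
  congr (Num.max _ _)%:E; rewrite /monomial_re !mulNr.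
  by case: (_ * _ * _).
rewrite XA YA AN subee//.
by rewrite -XA; exact: fA.
Qed.

Lemma integral_monomial_re_eq c n :
  (\int[mu]_z (monomial_re c n n z)%:E = (Re c / n.+1%:R)%:E)%E.
Proof.
rewrite EFinM -integral_disk_sqn -integralZl//.
  apply: eq_integral => z _; rewrite -EFinM; congr EFin.
  rewrite /monomial_re -mulrA -exprMn /sqn.
  have -> : z * z^*%C = (normc z ^+ 2)%:C.
    rewrite normc_sqr; case: z => a b /=; simpc; congr (_ +i* _); ring.
  by rewrite -rmorphXn /=; case: c => a b /=; ring.
apply/integrableP; split.
  by apply/measurable_EFinP; apply: measurable_funX; exact: measurable_sqn.
rewrite (eq_integral (fun z => (sqn z ^+ n)%:E)) ?integral_disk_sqn ?ltry//.
by move=> z _; rewrite /= ger0_norm// exprn_ge0// sqr_ge0.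
Qed.

Definition cpoly (N : nat) (c : nat -> C) (z : C) : C :=
  \sum_(0 <= i < N) c i * z ^+ i.

Lemma measurable_cpoly N c : measurable_fun setT (cpoly N c).
Proof.
rewrite /cpoly; elim: N => [|N ih].
  by under eq_fun do rewrite big_geq//; exact: measurable_cst.
under eq_fun do rewrite big_nat_recr//=.
by apply: measurable_funCD => //; apply: measurable_funCM => //; exact: measurable_funCX.
Qed.

Lemma measurable_cpoly_sqr N c :
  measurable_fun setT (fun z => (normc (cpoly N c z) ^+ 2)%:E).
Proof.
apply/measurable_EFinP; apply: measurable_funX; apply: measurable_normc.
exact: measurable_cpoly.
Qed.

(** Parseval's identity, by orthogonality and the radial moments. *)
Lemma integral_cpoly_sqr (N : nat) (c : nat -> C) :
  (\int[mu]_z (normc (cpoly N c z) ^+ 2)%:E =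
   (\sum_(0 <= i < N) normc (c i) ^+ 2 / i.+1%:R)%:E)%E.
Proof.
transitivity (\int[mu]_z (\sum_(0 <= i < N) \sum_(0 <= j < N)
    (monomial_re (c i * (c j)^*%C) i j z)%:E))%E.
  apply: eq_integral => z _;
    rewrite /cpoly normc_sqrE rmorph_sum /= big_distrlr /= Re_sum.
  rewrite -sumEFin; apply: eq_bigr => i _; rewrite Re_sum -sumEFin.
  apply: eq_bigr => j _; congr EFin; rewrite /monomial_re; congr Re.
  rewrite rmorphM rmorphXn /=; ring.
have ii i j := integrable_monomial_re (c i * (c j)^*%C) i j.
rewrite integral_sum//; last first.
  by move=> i; apply: integrable_sum => // j _; exact: ii.
rewrite -sumEFin; apply: eq_big_nat => i /andP[_ iN].
rewrite integral_sum//; last by move=> j; exact: ii.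
rewrite (bigD1_seq i) ?mem_index_iota ?iota_uniq//=.
rewrite integral_monomial_re_eq big1 ?adde0 -?normc_sqrE//.
by move=> j ij; rewrite integral_monomial_re_neq// eq_sym.
Qed.

End orthogonality.

(** * Lower integrals and Fatou's lemma *)

Lemma limn_einf_ge0 (R : realType) (f : nat -> \bar R) : (forall n, 0 <= f n)%E ->
  (0 <= limn_einf f)%E.
Proof.
move=> f0; rewrite limn_einf_lim; apply: lime_ge; first exact: is_cvg_einfs.
by apply: nearW => n; apply: le_ereal_inf_tmp => _ [m _ <-].
Qed.

Section fatou.
Context d (T : measurableType d) (R : realType) (m : {measure set T -> \bar R}).

(** The integral of a nonnegative function is a supremum over the simple
    functions below it, whether or not the function is measurable. This is how
    the supremum over the unit ball of A^2 is bounded from below: it is not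
    clear that it is a measurable function of the configuration. *)
Lemma le_integral_of_le (f g : T -> \bar R) : (forall x, 0 <= f x)%E ->
  (forall x, f x <= g x)%E -> (\int[m]_x f x <= \int[m]_x g x)%E.
Proof.
move=> f0 fg; rewrite !ge0_integralTE//; last by move=> x; exact: le_trans (fg x).
apply: ereal_sup_le => _ [h hf <-]; exists h => // x.
exact: le_trans (hf x) (fg x).
Qed.

(** All limits (in the degree of the polynomials, and in N) are taken with this
    form of Fatou's lemma: the bound on the integrals is uniform, and only the
    pointwise behaviour has to be computed. *)
Lemma fatou_bound (f : nat -> T -> \bar R) (g : T -> \bar R) (c : \bar R) :
  (forall n, measurable_fun setT (f n)) -> (forall n x, 0 <= f n x)%E ->
  (forall n, \int[m]_x f n x <= c)%E ->
  (forall x, 0 <= g x)%E -> (forall x, g x <= limn_einf (f ^~ x))%E ->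
  (\int[m]_x g x <= c)%E.
Proof.
move=> mf f0 fc g0 gf.
apply: (@le_trans _ _ (\int[m]_x limn_einf (f ^~ x))%E).
  exact: le_integral_of_le.
apply: (le_trans (fatou _ _ _ _)) => //.
rewrite limn_einf_lim; apply: lime_le; first exact: is_cvg_einfs.
apply: nearW => n; apply: le_trans (fc n).
by apply: ereal_inf_lbound; exists n => /=.
Qed.

End fatou.

(** * The Bergman kernel *)

Section kernel_series.
Variable R : realType.
Local Notation C := R[i].
Local Notation Re := (@complex.Re R).
Local Notation Im := (@complex.Im R).
Local Notation mu := (@disk_area R).

(** For r < 1, dividing by 1 - r shows the reason: 1 + r + .. + r^(n - 1) has n
    terms, each of which is at least r^n. *)
Lemma natmul_expr_le (r : R) n : 0 <= r <= 1 -> n%:R * r ^+ n * (1 - r) <= 1 - r ^+ n.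
Proof.
move=> /andP[r0 r1]; elim: n => [|n ih]; first by rewrite !mul0r expr0 subrr.
have rn0 : 0 <= r ^+ n by rewrite exprn_ge0.
have rn1 : r ^+ n.+1 <= 1 by rewrite exprn_ile1.
apply: (@le_trans _ _ (r * (1 - r ^+ n) + r ^+ n.+1 * (1 - r))).
  rewrite -natr1 exprS.
  have -> : (n%:R + 1) * (r * r ^+ n) * (1 - r) =
     r * (n%:R * r ^+ n * (1 - r)) + r * r ^+ n * (1 - r) by ring.
  by rewrite lerD2r ler_wpM2l.
have : r * (1 - r ^+ n.+1) <= 1 - r ^+ n.+1 by rewrite ler_piMl ?subr_ge0.
rewrite exprS; lra.
Qed.

(** Writing t = r^2 leaves a spare factor r^n. *)
Lemma cvg_natmul_expr (t : R) : 0 <= t < 1 -> (fun n => n%:R * t ^+ n) @ \oo --> (0 : R).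
Proof.
move=> /andP[t0 t1]; pose r := Num.sqrt t.
have r0 : 0 <= r by exact: sqrtr_ge0.
have rt : r * r = t by rewrite -expr2 sqr_sqrtr.
have r1 : r < 1 by rewrite -(@ltr_pXn2r _ 2) ?nnegrE// expr1n expr2 rt.
apply: (@squeeze_cvgr _ _ _ _ (cst 0) (fun n => (1 - r)^-1 * r ^+ n)); last 2 first.
- exact: cvg_cst.
- rewrite -[X in _ --> X](mulr0 (1 - r)^-1); apply: cvgM; first exact: cvg_cst.
  by apply: cvg_expr; rewrite ger0_norm.
apply: nearW => n; rewrite mulr_ge0 ?exprn_ge0//= -rt exprMn mulrA.
rewrite ler_wpM2r ?exprn_ge0// -[leRHS]mul1r ler_pdivlMr ?subr_gt0//.
apply: le_trans (natmul_expr_le n _) _; first by rewrite r0 ltW.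
by rewrite gerBl exprn_ge0.
Qed.

(** Partial sums of the power series of (1 - u)^-2. At u = x conj(y) they are
    the reproducing kernels of the spaces of polynomials of bounded degree. *)
Definition kernel_sum (A : comNzRingType) (N : nat) (u : A) :
  A := \sum_(0 <= i < N) i.+1%:R * u ^+ i.

Lemma kernel_sumE (A : comNzRingType) N (u : A) :
  (1 - u) ^+ 2 * kernel_sum N u = 1 - u ^+ N - N%:R * u ^+ N * (1 - u).
Proof.
elim: N => [|N ih]; first by rewrite /kernel_sum big_geq// expr0 !mul0r mulr0 subrr subr0.
rewrite /kernel_sum big_nat_recr//= mulrDr -/(kernel_sum N u) ih (exprS u N) -natr1; ring.
Qed.

Lemma normc_nat n : normc (n%:R : C) = n%:R.
Proof. by rewrite normcMn normc1. Qed.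

Lemma cvg_kernel_sum (u : C) : normc u < 1 ->
  (fun N => normc (kernel_sum N u - (1 - u) ^- 2)) @ \oo --> (0 : R).
Proof.
move=> u1.
have u0 : 1 - u != 0.
  by apply/eqP => /eqP; rewrite subr_eq0 => /eqP E; move: u1; rewrite -E normc1 ltxx.
pose a := normc ((1 - u) ^- 2); pose t := normc u.
have tt : 0 <= t < 1 by rewrite normc_ge0.
apply: (@squeeze_cvgr _ _ _ _ (cst 0)
  (fun n => a * (t ^+ n + n%:R * t ^+ n * normc (1 - u)))); last 2 first.
- exact: cvg_cst.
- rewrite -[X in _ --> X](mulr0 a); apply: cvgM; first exact: cvg_cst.
  rewrite -[X in _ --> X](addr0 0); apply: cvgD.
    by apply: cvg_expr; rewrite ger0_norm//; case/andP: tt.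
  rewrite -[X in _ --> X](mul0r (normc (1 - u))).
  by apply: cvgM; [exact: cvg_natmul_expr|exact: cvg_cst].
apply: nearW => n; rewrite normc_ge0 /=.
have -> : kernel_sum n u - (1 - u) ^- 2 =
   (1 - u) ^- 2 * (- (u ^+ n + n%:R * u ^+ n * (1 - u))).
  apply: (@mulfI _ ((1 - u) ^+ 2)); first by rewrite expf_neq0.
  rewrite mulrBr kernel_sumE mulrA !mulfV ?expf_neq0//; ring.
rewrite normcM ler_wpM2l ?normc_ge0// normcN.
by apply: (le_trans (le_normcD _ _)); rewrite !normcM normc_nat normcX.
Qed.

Lemma cvg_Re (v : nat -> C) (l : C) : (fun N => normc (v N - l)) @ \oo --> (0 : R) ->
  (fun N => Re (v N)) @ \oo --> Re l.
Proof.
move=> vl; apply/cvgrPdist_le => e e0.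
move/cvgrPdist_le : vl => /(_ e e0); apply: filterS => n.
rewrite sub0r normrN ger0_norm ?normc_ge0//; apply: le_trans.
by rewrite distrC (le_trans _ (ler_Re_normc _))//; case: (v n) l => a b [].
Qed.

Lemma cvg_Im (v : nat -> C) (l : C) : (fun N => normc (v N - l)) @ \oo --> (0 : R) ->
  (fun N => Im (v N)) @ \oo --> Im l.
Proof.
move=> vl; apply/cvgrPdist_le => e e0.
move/cvgrPdist_le : vl => /(_ e e0); apply: filterS => n.
rewrite sub0r normrN ger0_norm ?normc_ge0//; apply: le_trans.
by rewrite distrC (le_trans _ (ler_Im_normc _))//; case: (v n) l => a b [].
Qed.

Lemma cvg_normc_sqr (v : nat ->
  C) (l : C) : (fun N => normc (v N - l)) @ \oo --> (0 : R) ->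
  (fun N => normc (v N) ^+ 2) @ \oo --> normc l ^+ 2.
Proof.
move=> vl; rewrite normc_sqr; under eq_fun do rewrite normc_sqr.
apply: cvgD.
  by apply: (cvg_comp (fun N => Re (v N)) (fun x : R => x ^+ 2) (cvg_Re vl));
    exact: exprn_continuous.
by apply: (cvg_comp (fun N => Im (v N)) (fun x : R => x ^+ 2) (cvg_Im vl));
  exact: exprn_continuous.
Qed.

Lemma kernel_sum_real N (t : R) : kernel_sum N t%:C = (kernel_sum N t)%:C.
Proof.
rewrite /kernel_sum rmorph_sum; apply: eq_bigr => i _.
by rewrite rmorphM /= rmorph_nat -rmorphXn.
Qed.

Lemma kernel_sum_le N (t : R) : 0 <= t < 1 -> kernel_sum N t <= (1 - t) ^- 2.
Proof.
move=> /andP[t0 t1]; have t2 : 0 < 1 - t by rewrite subr_gt0.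
rewrite -[leRHS]mul1r ler_pdivlMr ?exprn_gt0// mulrC kernel_sumE.
have h1 : 0 <= t ^+ N by rewrite exprn_ge0.
have h2 : 0 <= N%:R * t ^+ N * (1 - t) by rewrite !mulr_ge0 ?exprn_ge0// ltW.
by lra.
Qed.

(** The gap of z to the unit circle: K(z, z) = (gap z)^-2. *)
Definition gap (z : C) : R := 1 - sqn z.

(** The kernel has modulus |K(x, y)| = (kden x y)^-1. *)
Definition kden (x y : C) : R := normc (1 - x * y^*%C) ^+ 2.

Lemma gap_gt0 z : disk R z -> 0 < gap z.
Proof. by move=> /diskE; rewrite subr_gt0. Qed.

(** Both the Cauchy-Schwarz inequality |K(x, y)|^2 <= K(x, x) K(y, y) and its
    defect, governed by |x - y|, can be read off this identity. *)
Lemma kdenE x y : kden x y = gap x * gap y + normc (x - y) ^+ 2.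
Proof.
by rewrite /kden /gap /sqn !normc_sqr; case: x y => a b [c d] /=; ring.
Qed.

Lemma kden_gt0 x y : disk R x -> disk R y -> 0 < kden x y.
Proof.
move=> dx dy; rewrite kdenE; apply: ltr_pwDl; last exact: sqr_ge0.
by rewrite mulr_gt0// gap_gt0.
Qed.

Lemma kdenC x y : kden x y = kden y x.
Proof. by rewrite !kdenE mulrC -normcN opprB. Qed.

Lemma normc_disk_mul x y : disk R x -> disk R y -> normc (x * y^*%C) < 1.
Proof.
move=> /normc_lt1 x1 /normc_lt1 y1; rewrite normcM normc_conj.
by rewrite mulr_ilt1 ?normc_ge0.
Qed.

Lemma normc_inv_sqr x y : normc ((1 - x * y^*%C) ^- 2) ^+ 2 = kden x y ^- 2.
Proof. by rewrite normcV normcX exprVn. Qed.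

Lemma measurable_kden d (T : measurableType d) (f g : T -> C) :
  measurable_fun setT f -> measurable_fun setT g ->
  measurable_fun setT (fun t => kden (f t) (g t)).
Proof.
move=> mf mg; apply: measurable_funX; apply: measurable_normc.
apply: measurable_funCD; first exact: measurable_cst.
apply: measurable_funCN; apply: measurable_funCM => //.
exact: measurable_funCJ.
Qed.

(** Bessel's inequality: the truncations of K_x are polynomials whose squared
    norm is a partial sum of K(x, x). *)
Lemma integral_kernel_sqr_le x : disk R x ->
  (\int[mu]_y (kden x y ^- 2)%:E <= (gap x ^- 2)%:E)%E.
Proof.
move=> dx; pose c i : C := i.+1%:R * x^*%C ^+ i.
have cE n y : cpoly n c y = kernel_sum n (y * x^*%C).
  by apply: eq_bigr => i _; rewrite /c mulrC exprMn; ring.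
pose g y : R := \1_(disk R) y * kden x y ^- 2.
have k0 y : 0 <= kden x y ^- 2 by rewrite invr_ge0 exprn_ge0// sqr_ge0.
have g0 y : 0 <= g y by rewrite mulr_ge0.
have mk : measurable_fun setT (fun y => kden x y ^- 2).
  apply: measurable_funV; apply: measurable_funX.
  by apply: measurable_kden => //; exact: measurable_cst.
have mg : measurable_fun setT g.
  by apply: measurable_funM => //; apply: measurable_indic; exact: measurable_disk.
apply: (@le_trans _ _ (\int[mu]_y (g y)%:E)%E).
  apply: le_integral_disk.
  - exact/measurable_EFinP.
  - exact/measurable_EFinP.
  - by move=> y; rewrite lee_fin.
  - by move=> y; rewrite lee_fin.
  - by move=> y dy; rewrite lee_fin /g indicE mem_set// mul1r.
have f0 n y : (0 <= (normc (cpoly n c y) ^+ 2)%:E)%E by rewrite lee_fin sqr_ge0.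
apply: (@fatou_bound _ _ _ _ (fun n y => (normc (cpoly n c y) ^+ 2)%:E)) => //.
- by move=> n; exact: measurable_cpoly_sqr.
- move=> n; rewrite integral_cpoly_sqr lee_fin.
  have -> : \sum_(0 <= i < n) normc (c i) ^+ 2 / i.+1%:R = kernel_sum n (sqn x).
    apply: eq_bigr => i _.
    rewrite /c normcM normc_nat normcX normc_conj exprMn -exprM mulnC exprM.
    by rewrite -/(sqn x) expr2 mulrAC mulfK// pnatr_eq0.
  by apply: kernel_sum_le; rewrite sqr_ge0; exact/diskE.
- move=> y; rewrite /g indicE; case: (boolP (y \in disk R)) => [|_]; last first.
    by rewrite mul0r; exact: limn_einf_ge0.
  rewrite inE mul1r => dy.
  suff fy : (fun n => (normc (cpoly n c y) ^+ 2)%:E) @ \oo --> (kden x y ^- 2)%:E.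
    by have [-> _] := cvg_limn_einf_sup fy.
  rewrite kdenC -normc_inv_sqr; apply: cvg_EFin; first exact: nearW.
  apply: cvg_normc_sqr; under eq_fun do rewrite cE.
  by apply: cvg_kernel_sum; exact: normc_disk_mul.
Qed.

End kernel_series.

(** * Linear statistics of a configuration *)

Section point_sums.
Variables (R : realType) (r : R).
Hypothesis r1 : r < 1.
Local Notation C := R[i].

Definition cball : set C := [set z | sqn z <= r].
Local Notation B := cball.

Lemma cball_subdisk : B `<=` disk R.
Proof. by move=> z /= zr; apply/diskE; exact: le_lt_trans r1. Qed.

Lemma finite_points_cball (X : Conf R) : finite_set (points X `&` B).
Proof.
apply: points_locally_finite; last exact: cball_subdisk.
exact: compact_cball.
Qed.

Definition points_in (X : Conf R) : {fset C} := fset_set (points X `&` B).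

Lemma in_points_in X x : (x \in points_in X) = (x \in points X `&` B).
Proof. by rewrite in_fset_set//; exact: finite_points_cball. Qed.

(** For u vanishing outside the ball this is the sum of u over all the points
    of X; the ball only makes the sum finite. *)
Definition lin_stat (u : C -> R) (X : Conf R) : R := \sum_(x <- points_in X) u x.

Lemma measurable_cball : measurable B.
Proof.
have -> : B = @sqn R @^-1` `]-oo, r].
  by apply/seteqP; split => z; rewrite /= in_itv.
by rewrite -[X in measurable X]setTI; exact: measurable_sqn.
Qed.

Lemma lin_stat_indicE (E : set C) X :
  lin_stat (\1_E) X = #|` fset_set (points X `&` (B `&` E))|%:R.
Proof.
rewrite /lin_stat; transitivity (\sum_(x <- points_in X | x \in E) (1 : R)).
  rewrite [RHS]big_mkcond; apply: eq_bigr => x _; rewrite indicE.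
  by case: (x \in E).
rewrite big_const_seq iter_addr_0; congr _%:R.
rewrite -size_filter; apply: perm_size; apply: uniq_perm.
- by rewrite filter_uniq// fset_uniq.
- exact: fset_uniq.
have fB := finite_points_cball X.
move=> x; rewrite mem_filter in_points_in in_fset_set; last first.
  by apply: sub_finite_set fB => y [? []].
by rewrite !in_setI; case: (x \in E) (x \in points X) (x \in B) => [] [] [].
Qed.

(** The number of points in a Borel set takes countably many values, and its
    level sets are the generators of the sigma-algebra. *)
Lemma measurable_lin_stat_indic (E : set C) : measurable E ->
  measurable_fun setT (lin_stat (\1_E)).
Proof.
move=> mE _ Y mY; rewrite setTI.
have -> : lin_stat (\1_E) @^-1` Y = \bigcup_(n in [set n | Y (n%:R)])
    [set X : Conf R | (points X `&` (B `&` E) #= `I_n)%card].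
  apply/seteqP; split => [X|X [n /= Yn nE]] /=; last first.
    by rewrite lin_stat_indicE (card_fset_set nE).
  rewrite lin_stat_indicE => YX; eexists; first exact: YX.
  apply/card_eqP.
  have fBE : finite_set (points X `&` (B `&` E)).
    by apply: sub_finite_set (finite_points_cball X) => y [? []].
  have [n nE] := (finite_setP _).1 fBE.
  by rewrite (card_fset_set nE); exact/card_eqP.
apply: bigcup_measurable => n _; apply: sub_sigma_algebra.
exists (B `&` E), n; split => //.
- by apply: measurableI => //; exact: measurable_cball.
- by move=> z [/cball_subdisk].
Qed.

Import HBNNSimple.

(** Simple approximations of u converge pointwise, hence in each finite sum. *)
Lemma measurable_lin_stat_ge0 (u : C -> R) : measurable_fun setT u ->
  (forall z, 0 <= u z) -> measurable_fun setT (lin_stat u).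
Proof.
move=> mu u0; have mEu : measurable_fun setT (EFin \o u) by exact/measurable_EFinP.
pose g := nnsfun_approx measurableT mEu.
apply: (@measurable_fun_cvg _ (Conf R) R setT (fun n => lin_stat (g n)) (lin_stat u)).
  move=> n.
  have -> : lin_stat (g n) = fun X => \sum_(i < #|` fset_set (range (g n))|)
      ((fset_set (range (g n)))`_i *
        lin_stat (\1_(g n @^-1` [set (fset_set (range (g n)))`_i])) X).
    apply/funext => X; rewrite /lin_stat.
    under eq_bigr do rewrite fimfunEord.
    by rewrite exchange_big /=; apply: eq_bigr => i _; rewrite mulr_sumr.
  apply: measurable_sum => i; apply: measurable_funM; first exact: measurable_cst.
  exact: measurable_lin_stat_indic.
move=> X _; rewrite /lin_stat.
apply: (@cvg_big _ _ (@GRing.add R)) => [|x _].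
  by move=> [a b]; exact: (@add_continuous R (a, b)).
have := @cvg_nnsfun_approx _ _ _ _ measurableT _ mEu (fun x _ => u0 x) x Logic.I.
by move/fine_cvg.
Qed.

Lemma measurable_lin_stat (u : C -> R) : measurable_fun setT u ->
  measurable_fun setT (lin_stat u).
Proof.
move=> mu.
have -> : lin_stat u = lin_stat (fun x => Num.max (u x) 0) \- lin_stat (fun x =>
  Num.max (- u x) 0).
  apply/funext => X; rewrite /lin_stat /= -sumrB; apply: eq_bigr => x _.
  by rewrite /Num.max oppr_lt0; case: ltgtP; lra.
apply: measurable_funB; apply: measurable_lin_stat_ge0.
- by apply: measurable_maxr => //; exact: measurable_cst.
- by move=> z; rewrite le_max lexx orbT.
- apply: measurable_maxr; last exact: measurable_cst.
  exact: measurableT_comp.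
- by move=> z; rewrite le_max lexx orbT.
Qed.

Lemma esum_points_lin_stat (a : C -> R) X : (forall z, 0 <= a z) ->
  (forall z, ~ B z -> a z = 0) ->
  (\esum_(x in points X) (a x)%:E = (lin_stat a X)%:E)%E.
Proof.
move=> a0 aB.
rewrite (_ : (\esum_(x in points X) (a x)%:E)%E =
  (\esum_(x in points X `&` B) (a x)%:E)%E).
  have fB := finite_points_cball X.
  rewrite esum_fset//; last by move=> x _; rewrite lee_fin.
  by rewrite fsbig_finite//= sumEFin.
rewrite esum_mkcondr; apply: eq_esum => x _; case: ifPn => //.
by rewrite notin_setE => /aB ->.
Qed.

(** The product of two sums is its diagonal part plus a sum over ordered pairs
    of distinct points: the one-point and two-point correlation functions
    govern these two terms. *)
Lemma lin_stat_mul (a b : C -> R) X : (forall z, 0 <= a z) -> (forall z, 0 <= b z) ->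
  (forall z, ~ B z -> a z = 0) -> (forall z, ~ B z -> b z = 0) ->
  ((lin_stat a X * lin_stat b X)%:E = (lin_stat (fun x => a x * b x)%R X)%:E +
    \esum_(t in @distinct_points R X 2)
      (a (tnth t ord0) * b (tnth t ord_max))%:E)%E.
Proof.
move=> a0 b0 aB bB.
pose Q x := points X `&` ~` [set x].
have -> : (\esum_(t in @distinct_points R X 2)
      (a (tnth t ord0) * b (tnth t ord_max))%:E =
   \esum_(x in points X) \esum_(y in Q x) (a x * b y)%:E)%E.
  rewrite esum_esum; last by move=> x y _ _; rewrite lee_fin mulr_ge0.
  rewrite (reindex_esum (points X `*`` Q) _ (fun p : C * C => [tuple p.1; p.2]))//.
  split.
  - move=> [x y] [/= Xx [Xy xy]]; split => /=.
      by rewrite inE andbT; apply/eqP => E; apply: xy.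
    by move=> i; rewrite (tnth_nth 0); case: i => -[|[|//]].
  - by move=> [x y] [x' y'] _ _ [-> ->].
  - move=> t [ut Xt]; exists (tnth t ord0, tnth t ord_max) => /=; last first.
      apply: eq_from_tnth => i; rewrite (tnth_nth 0) /=.
      by case: i => -[|[|//]] h /=; congr (tnth t _); apply: val_inj.
    split; first exact: Xt.
    split; first exact: Xt.
    by move=> /= /(tuple_uniqP _ ut).
have -> : ((lin_stat (fun x =>
  a x * b x)%R X)%:E = \esum_(x in points X) (a x * b x)%:E)%E.
  rewrite esum_points_lin_stat// => z; first by rewrite mulr_ge0.
  by move=> /aB ->; rewrite mul0r.
rewrite -esumD; last 2 first.
- by move=> x _; rewrite lee_fin mulr_ge0.
- by move=> x _; apply: esum_ge0 => y _; rewrite lee_fin mulr_ge0.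
have rb0 : 0 <= lin_stat b X by apply: sumr_ge0.
have -> : lin_stat a X * lin_stat b X = lin_stat (fun x => a x * lin_stat b X) X.
  by rewrite /lin_stat mulr_suml.
rewrite -esum_points_lin_stat//; last 2 first.
- by move=> z; rewrite mulr_ge0.
- by move=> z /aB ->; rewrite mul0r.
apply: eq_esum => x Xx.
have -> : a x * lin_stat b X = lin_stat (fun y =>
  a x * b y) X by rewrite /lin_stat mulr_sumr.
rewrite -esum_points_lin_stat//; last 2 first.
- by move=> z; rewrite mulr_ge0.
- by move=> z /bB ->; rewrite mulr0.
rewrite (esumID [set x]); last by move=> y _; rewrite lee_fin mulr_ge0.
rewrite (_ : points X `&` [set x] = [set x]).
  by rewrite esum_set1// lee_fin mulr_ge0.
by apply/seteqP; split => [y []|y ->].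
Qed.



End point_sums.

(** * First and second moments of linear statistics *)

Section expectations.
Variables (R : realType) (P : probability (Conf R) R).
Hypothesis hP : determinantal (@bergman_kernel R) P.
Variable r : R.
Hypothesis r1 : r < 1.
Local Notation C := R[i].
Local Notation B := (@cball R r).
Local Notation mu := (@disk_area R).
Local Notation Re := (@complex.Re R).

Lemma bergman_kernel_diag (z : C) : disk R z -> bergman_kernel z z = (gap z ^- 2)%:C.
Proof.
move=> dz; rewrite /bergman_kernel.
have -> : 1 - z * z^*%C = (gap z)%:C.
  rewrite /gap /sqn normc_sqr; case: (z) => a b /=; simpc.
  by congr (_ +i* _); ring.
by rewrite -rmorphXn /= fmorphV.
Qed.

Lemma bergman_kernel_conj (x y : C) : bergman_kernel y x = (bergman_kernel x y)^*%C.
Proof.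
rewrite /bergman_kernel fmorphV rmorphXn rmorphB rmorph1 rmorphM /= conjcK.
by rewrite (mulrC x^*%C).
Qed.

Lemma det_kernel1 (z : C) : disk R z ->
  Re (\det (\matrix_(i < 1, j < 1) bergman_kernel (tnth [tuple z] i) (tnth [tuple z]
    j))) =
  gap z ^- 2.
Proof. by move=> dz; rewrite det_mx11 mxE /= bergman_kernel_diag. Qed.

Lemma det_kernel2 (x y : C) : disk R x -> disk R y ->
  Re (\det (\matrix_(i < 2, j < 2) bergman_kernel (tnth [tuple x;
    y] i) (tnth [tuple x; y] j))) =
  gap x ^- 2 * gap y ^- 2 - kden x y ^- 2.
Proof.
move=> dx dy; rewrite (expand_det_row _ ord0) !big_ord_recl big_ord0 addr0.
rewrite /cofactor !det_mx11 !mxE /=.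
rewrite !(tnth_nth 0) /= !bergman_kernel_diag// expr0 expr1 mul1r.
rewrite (bergman_kernel_conj x y) mulrA mulrN1 mulNr -rmorphM.
rewrite raddfB /=; congr (_ - _).
by rewrite -normc_sqrE normc_inv_sqr.
Qed.

Lemma gap_expN2_ge0 (z : C) : 0 <= gap z ^- 2.
Proof. by rewrite invr_ge0 sqr_ge0. Qed.

Lemma measurable_gapN2 : measurable_fun setT (fun z : C => gap z ^- 2).
Proof.
apply: measurable_funV; apply: measurable_funX; apply: measurable_funB => //.
exact: measurable_sqn.
Qed.

Section one_point.
Variable a : C -> R.
Hypotheses (ma : measurable_fun setT a) (a0 : forall z, 0 <= a z)
  (aB : forall z, ~ B z -> a z = 0).

Lemma expectation_lin_stat :
  (\int[P]_X (lin_stat r a X)%:E = \int[mu]_z (a z * gap z ^- 2)%:E)%E.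
Proof.
transitivity (\int[P]_X (\esum_(t in @distinct_points R X 1) (a (tnth t ord0))%:E))%E.
  apply: eq_integral => X _; rewrite -esum_points_lin_stat//.
  rewrite (reindex_esum (points X) _ (fun x : C => [tuple x]))//.
  split.
  - by move=> x Xx /=; split => // i; rewrite (tnth_nth 0); case: i => -[|].
  - by move=> x x' _ _ [].
  - move=> t [ut Xt]; exists (tnth t ord0); first exact: Xt.
    apply: eq_from_tnth => i; rewrite (tnth_nth 0) /=.
    by case: i => -[|//] h /=; congr (tnth t _); apply: val_inj.
rewrite (hP (ltn0Sn 0) (phi := fun t => (a (tnth t ord0))%:E)); last 2 first.
- apply/measurable_EFinP; apply: measurableT_comp ma _; exact: measurable_tnth.
- by move=> t; rewrite lee_fin.
rewrite -integral_disk_area; last 2 first.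
- apply/measurable_EFinP; apply: measurable_funM => //; exact: measurable_gapN2.
- by move=> z; rewrite lee_fin mulr_ge0// gap_expN2_ge0.
rewrite /=; apply: eq_integral => z; rewrite inE => dz.
by rewrite -EFinM -det_kernel1// (tnth_nth 0).
Qed.

End one_point.

Section two_point.
Variables a b : C -> R.
Hypotheses (ma : measurable_fun setT a) (a0 : forall z, 0 <= a z)
  (aB : forall z, ~ B z -> a z = 0).
Hypotheses (mb : measurable_fun setT b) (b0 : forall z, 0 <= b z)
  (bB : forall z, ~ B z -> b z = 0).

(** The two-point correlation function K(x, x) K(y, y) - |K(x, y)|^2. *)
Definition rho2 (x y : C) : R := gap x ^- 2 * gap y ^- 2 - kden x y ^- 2.

Lemma rho2_ge0 x y : disk R x -> disk R y -> 0 <= rho2 x y.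
Proof.
move=> dx dy; have [px py] := (gap_gt0 dx, gap_gt0 dy).
have kxy := kden_gt0 dx dy.
have k2 : 0 < kden x y ^+ 2 by exact: exprn_gt0.
have p2 : 0 < (gap x * gap y) ^+ 2 by rewrite exprn_gt0// mulr_gt0.
rewrite /rho2 subr_ge0 -invfM -exprMn lef_pV2 ?posrE//.
apply: lerXn2r.
- by rewrite nnegrE mulr_ge0// ltW.
- by rewrite nnegrE ltW.
- by rewrite kdenE lerDl sqr_ge0.
Qed.

(** Off the disk [rho2] has no definite sign, but there a or b vanishes. So
    Tonelli's theorem can be applied on the whole plane. *)
Lemma ab_rho2_ge0 x y : 0 <= a x * b y * rho2 x y.
Proof.
have [Bx|/aB ->] := pselect (B x); last by rewrite !mul0r.
have [By|/bB ->] := pselect (B y); last by rewrite mulr0 mul0r.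
by rewrite !mulr_ge0// rho2_ge0//; exact: cball_subdisk r1 _ _.
Qed.

Lemma measurable_rho2 d (T : measurableType d) (f g : T -> C) :
  measurable_fun setT f -> measurable_fun setT g ->
  measurable_fun setT (fun t => rho2 (f t) (g t)).
Proof.
move=> mf mg; apply: measurable_funB.
  by apply: measurable_funM; apply: measurableT_comp measurable_gapN2 _.
by apply: measurable_funV; apply: measurable_funX; exact: measurable_kden.
Qed.

Lemma expectation_pairs :
  (\int[P]_X (\esum_(t in @distinct_points R X 2)
      (a (tnth t ord0) * b (tnth t ord_max))%:E) =
   \int[mu \x mu]_p (a p.1 * b p.2 * rho2 p.1 p.2)%:E)%E.
Proof.
rewrite (hP (ltn0Sn 1) (phi := fun t => (a (tnth t ord0) * b (tnth t ord_max))%:E));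
  last 2 first.
- apply/measurable_EFinP; apply: measurable_funM.
    apply: measurableT_comp ma _; exact: measurable_tnth.
  apply: measurableT_comp mb _; exact: measurable_tnth.
- by move=> t; rewrite lee_fin mulr_ge0.
pose F (p : C * C) : \bar R := (a p.1 * b p.2 * rho2 p.1 p.2)%:E.
have mF : measurable_fun setT F.
  apply/measurable_EFinP; apply: measurable_funM; last exact: measurable_rho2.
  by apply: measurable_funM; apply: measurableT_comp.
have F0 p : (0 <= F p)%E by rewrite lee_fin ab_rho2_ge0.
transitivity (\int[mu]_x fubini_F mu F x)%E; last by rewrite -fubini_tonelli1.
rewrite -(integral_disk_area (f := fubini_F mu F)); last 2 first.
- exact: (measurable_fun_fubini_tonelli_F _ mF).
- by move=> x; apply: integral_ge0 => y _.
apply: eq_integral => x; rewrite inE => dx.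
transitivity (\int[area R]_(y in disk R) F (x, y))%E; last first.
  apply: integral_disk_area; last by move=> y; exact: F0.
  apply: (measurableT_comp mF); exact: pair1_measurable.
rewrite /=; apply: eq_integral => y; rewrite inE => dy.
by rewrite /F -[rho2 _ _]/(_ - _) -(det_kernel2 dx dy) EFinM !(tnth_nth 0).
Qed.

Lemma expectation_lin_statM :
  (\int[P]_X (lin_stat r a X * lin_stat r b X)%:E =
   \int[mu]_z (a z * b z * gap z ^- 2)%:E +
   \int[mu \x mu]_p (a p.1 * b p.2 * rho2 p.1 p.2)%:E)%E.
Proof.
have ab0 z : 0 <= a z * b z by rewrite mulr_ge0.
have mab : measurable_fun setT (fun z => a z * b z) by exact: measurable_funM.
have abB z : ~ B z -> a z * b z = 0 by move=> /aB ->; rewrite mul0r.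
have mr (u : C -> R) : measurable_fun setT u -> measurable_fun setT (lin_stat r u).
  exact: measurable_lin_stat.
rewrite -expectation_pairs -(expectation_lin_stat mab ab0 abB).
rewrite -ge0_integralD//.
- by apply: eq_integral => X _; rewrite lin_stat_mul.
- by move=> X _; rewrite lee_fin sumr_ge0.
- by apply/measurable_EFinP; exact: mr.
- by move=> X _; apply: esum_ge0 => t _; rewrite lee_fin mulr_ge0.
- have -> : (fun X : Conf R => \esum_(t in @distinct_points R X 2)
      (a (tnth t ord0) * b (tnth t ord_max))%:E)%E =
      (fun X => (lin_stat r a X * lin_stat r b X - lin_stat r (fun z =>
        (a z * b z)%R) X)%:E).
    by apply/funext => X; rewrite EFinB lin_stat_mul// addeAC subee// add0e.
  by apply/measurable_EFinP; apply: measurable_funB; [apply: measurable_funM|]; exact: mr.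
Qed.

End two_point.
End expectations.

(** * A lower bound for second moments *)

Section variance.
Variables (R : realType) (P : probability (Conf R) R).
Hypothesis hP : determinantal (@bergman_kernel R) P.
Variable r : R.
Hypothesis r1 : r < 1.
Local Notation C := R[i].
Local Notation B := (@cball R r).
Local Notation mu := (@disk_area R).
Local Notation nu := (mu \x mu)%E.

Lemma ge0_fin_real (x : \bar R) (c : R) : (0 <= x)%E -> (x <= c%:E)%E ->
  exists2 y : R, 0 <= y & x = y%:E.
Proof.
case: x => [x| |] // x0 xc; first by exists x.
Qed.

(** |K(x, y)|^2 as a function of the pair, for integration on the product. *)
Definition ksq (p : C * C) : R := kden p.1 p.2 ^- 2.

Lemma ksq_ge0 p : 0 <= ksq p.
Proof. by rewrite invr_ge0 exprn_ge0// sqr_ge0. Qed.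

Lemma measurable_ksq : measurable_fun setT ksq.
Proof. by apply: measurable_funV; apply: measurable_funX; exact: measurable_kden. Qed.

Definition kform (f g : C -> R) : \bar R := (\int[nu]_p (f p.1 * g p.2 * ksq p)%:E)%E.

Section kform.
Variables f g : C -> R.
Hypotheses (mf : measurable_fun setT f) (mg : measurable_fun setT g).
Hypotheses (f0 : forall z, 0 <= f z) (g0 : forall z, 0 <= g z).

Lemma kform_meas : measurable_fun setT (fun p : C * C => (f p.1 * g p.2 * ksq p)%:E).
Proof.
apply/measurable_EFinP; apply: measurable_funM; last exact: measurable_ksq.
by apply: measurable_funM; apply: measurableT_comp.
Qed.

Lemma kform_int_ge0 (p : C * C) : (0 <= (f p.1 * g p.2 * ksq p)%:E)%E.
Proof. by rewrite lee_fin !mulr_ge0// ksq_ge0. Qed.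

Lemma kform_ge0 : (0 <= kform f g)%E.
Proof. by apply: integral_ge0 => p _; exact: kform_int_ge0. Qed.

End kform.

Lemma kformC (f g : C -> R) :
  measurable_fun setT f -> measurable_fun setT g ->
  (forall z, 0 <= f z) -> (forall z, 0 <= g z) -> kform f g = kform g f.
Proof.
move=> mf mg f0 g0; rewrite /kform.
rewrite (fubini_tonelli2 _ (kform_meas mf mg) (kform_int_ge0 f0 g0)).
rewrite (fubini_tonelli1 _ (kform_meas mg mf) (kform_int_ge0 g0 f0)).
apply: eq_integral => y _; apply: eq_integral => x _.
by rewrite /ksq /= kdenC (mulrC (f x)).
Qed.

(** Bessel's inequality, multiplied by f(x) and integrated in x. *)
Lemma kform_cst1_le (f : C -> R) : measurable_fun setT f -> (forall z, 0 <= f z) ->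
  (kform f (cst 1%R) <= \int[mu]_z (f z * gap z ^- 2)%:E)%E.
Proof.
move=> mf f0; rewrite /kform fubini_tonelli1//; last 2 first.
- exact: kform_meas.
- exact: kform_int_ge0.
apply: le_integral_disk.
- apply: measurable_fun_fubini_tonelli_F => //.
  + exact: (@kform_meas f (cst 1%R) mf (measurable_cst _)).
  + exact: (@kform_int_ge0 f (cst 1%R) f0 (fun=> ler01)).
- by apply/measurable_EFinP; apply: measurable_funM => //; exact: measurable_gapN2.
- by move=> x; apply: integral_ge0 => y _;
    exact: (@kform_int_ge0 f (cst 1%R) f0 (fun=> ler01) (x, y)).
- by move=> x; rewrite lee_fin mulr_ge0// gap_expN2_ge0.
move=> x dx; rewrite /fubini_F /=.
under eq_integral do rewrite mulr1 EFinM.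
rewrite ge0_integralZl//; last 3 first.
- by apply/measurable_EFinP; apply: measurableT_comp measurable_ksq _;
    exact: pair1_measurable.
- by move=> y _; rewrite lee_fin ksq_ge0.
- by rewrite lee_fin.
by rewrite EFinM lee_wpmul2l ?lee_fin//; exact: integral_kernel_sqr_le.
Qed.

Lemma gap_cball z : B z -> 1 - r <= gap z.
Proof. by move=> zr; rewrite /gap lerD2l lerN2. Qed.

Section bounded.
Variables (f g : C -> R) (M : R).
Hypotheses (mf : measurable_fun setT f) (mg : measurable_fun setT g).
Hypotheses (f0 : forall z, 0 <= f z) (g0 : forall z, 0 <= g z).
Hypotheses (fM : forall z, f z <= M) (gM : forall z, g z <= M).
Hypotheses (fB : forall z, ~ B z -> f z = 0) (gB : forall z, ~ B z -> g z = 0).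

Let M0 : 0 <= M. Proof. exact: le_trans (f0 0) (fM 0). Qed.

Lemma integral_gap_fin : exists2 y, 0 <= y & (\int[mu]_z (f z * gap z ^- 2)%:E)%E = y%:E.
Proof.
apply: (@ge0_fin_real _ (M * (1 - r) ^- 2)).
  by apply: integral_ge0 => z _; rewrite lee_fin mulr_ge0// gap_expN2_ge0.
apply: (@le_trans _ _ (\int[mu]_z (M * (1 - r) ^- 2)%:E)%E); last first.
  by rewrite integral_cst//= probability_setT mule1.
apply: ge0_le_integral => //.
- by move=> z _; rewrite lee_fin mulr_ge0// gap_expN2_ge0.
- by apply/measurable_EFinP; apply: measurable_funM => //; exact: measurable_gapN2.
- move=> z _; rewrite lee_fin; have [Bz|/fB ->] := pselect (B z); last first.
    by rewrite mul0r mulr_ge0// invr_ge0 exprn_ge0// subr_ge0 ltW.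
  have r0 : 0 < 1 - r by rewrite subr_gt0.
  have d := gap_cball Bz; have d0 := lt_le_trans r0 d.
  rewrite ler_pM// ?gap_expN2_ge0// lef_pV2 ?posrE ?exprn_gt0//.
  by apply: lerXn2r => //; rewrite nnegrE ltW.
Qed.

Lemma kform_fin : exists2 y, 0 <= y & kform f g = y%:E.
Proof.
apply: (@ge0_fin_real _ (M * M * ((1 - r) ^+ 2) ^- 2)); first exact: kform_ge0.
apply: (@le_trans _ _ (\int[nu]_z (M * M * ((1 - r) ^+ 2) ^- 2)%:E)%E); last first.
  by rewrite integral_cst//= probability_setT mule1.
have r0 : 0 < 1 - r by rewrite subr_gt0.
apply: ge0_le_integral => //.
- by move=> z _; exact: kform_int_ge0.
- exact: kform_meas.
- move=> [x y] _; rewrite lee_fin /ksq /=.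
  have c0 : 0 <= M * M * ((1 - r) ^+ 2) ^- 2.
    by rewrite !mulr_ge0// invr_ge0 !exprn_ge0// ltW.
  have [Bx|/fB ->] := pselect (B x); last by rewrite !mul0r.
  have [By|/gB ->] := pselect (B y); last by rewrite mulr0 mul0r.
  have dx := gap_cball Bx; have dy := gap_cball By.
  have dx0 := lt_le_trans r0 dx; have dy0 := lt_le_trans r0 dy.
  have k0 : (1 - r) ^+ 2 <= kden x y.
    apply: (@le_trans _ _ (gap x * gap y)); last by rewrite kdenE lerDl sqr_ge0.
    by rewrite expr2 ler_pM// ltW.
  have k1 : 0 < (1 - r) ^+ 2 by rewrite exprn_gt0.
  have k2 := lt_le_trans k1 k0.
  apply: ler_pM.
  + by rewrite mulr_ge0.
  + by rewrite invr_ge0 exprn_ge0// ltW.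
  + by rewrite ler_pM.
  have k3 : 0 < kden x y ^+ 2 by exact: exprn_gt0.
  have k4 : 0 < ((1 - r) ^+ 2) ^+ 2 by exact: exprn_gt0.
  rewrite lef_pV2 ?posrE//.
  by apply: lerXn2r => //; rewrite nnegrE ltW.
Qed.

(** The term K(x, x) K(y, y) of the two-point function factorises. *)
Lemma integral_rho2_kform :
  (\int[nu]_p (f p.1 * g p.2 * rho2 p.1 p.2)%:E + kform f g =
  (\int[mu]_z (f z * gap z ^- 2)%:E) * (\int[mu]_z (g z * gap z ^- 2)%:E))%E.
Proof.
have mdd (h : C -> R) : measurable_fun setT h ->
  measurable_fun setT (fun z => (h z * gap z ^- 2)%:E).
  by move=> mh; apply/measurable_EFinP; apply: measurable_funM => //;
    exact: measurable_gapN2.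
rewrite /kform -ge0_integralD//; last 4 first.
- by move=> p _; rewrite lee_fin; apply: (ab_rho2_ge0 r1 f0 fB g0 gB).
- apply/measurable_EFinP; apply: measurable_funM; last exact: measurable_rho2.
  by apply: measurable_funM; apply: measurableT_comp.
- by move=> p _; exact: kform_int_ge0.
- exact: kform_meas.
transitivity (\int[nu]_p ((f p.1 * gap p.1 ^- 2)%:E * (g p.2 * gap p.2 ^- 2)%:E))%E.
  apply: eq_integral => p _; rewrite -EFinD -EFinM; congr EFin.
  rewrite /rho2 /ksq; ring.
rewrite fubini_tonelli1//; last 2 first.
- by apply: emeasurable_funM; apply: (measurableT_comp (mdd _ _)).
- by move=> p; rewrite mule_ge0// lee_fin mulr_ge0// gap_expN2_ge0.
have h0 (h : C -> R) z : (forall z, 0 <= h z) -> (0 <= (h z * gap z ^- 2)%:E)%E.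
  by move=> hh; rewrite lee_fin mulr_ge0// gap_expN2_ge0.
transitivity (\int[mu]_x ((f x * gap x ^- 2)%:E * \int[mu]_z (g z * gap z ^- 2)%:E))%E.
  apply: eq_integral => x _; rewrite /fubini_F /= ge0_integralZl//.
  - exact: mdd.
  - by move=> z _; exact: h0.
  - exact: h0.
rewrite ge0_integralZr//.
- exact: mdd.
- by move=> z _; rewrite lee_fin mulr_ge0// gap_expN2_ge0.
- by apply: integral_ge0 => z _; rewrite lee_fin mulr_ge0// gap_expN2_ge0.
Qed.

End bounded.

Lemma measurable_max0 (u : C -> R) : measurable_fun setT u ->
  measurable_fun setT (fun z => Num.max (u z) 0).
Proof. by move=> mu; apply: measurable_maxr => //; exact: measurable_cst. Qed.

(** As u is bounded and vanishes off a compact ball of the disk, all terms below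
    are finite. The second moment is
    int u^2 K(x, x) + (int u K(x, x))^2 - int int u(x) u(y) |K(x, y)|^2. Dropping
    the square and replacing K(x, x) by int |K(x, y)|^2 dA(y), which is smaller
    by Bessel's inequality, leaves one half of the double integral of
    (u(x) - u(y))^2 |K(x, y)|^2. The computation is made with the positive part
    a and the negative part b of u, so that all integrands are nonnegative. *)
Lemma variance_lower_bound (u : C -> R) (M : R) : measurable_fun setT u ->
  (forall z, `|u z| <= M) -> (forall z, ~ B z -> u z = 0) ->
  (\int[nu]_p ((u p.1 - u p.2) ^+ 2 * ksq p)%:E <=
   \int[P]_X (lin_stat r u X ^+ 2)%:E + \int[P]_X (lin_stat r u X ^+ 2)%:E)%E.
Proof.
move=> meas_u uM uB.
have M0 : 0 <= M by exact: le_trans (uM 0).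
pose a z := Num.max (u z) 0; pose b z := Num.max (- u z) 0.
have ma : measurable_fun setT a by exact: measurable_max0.
have mb : measurable_fun setT b.
  by apply: measurable_max0; exact: measurableT_comp.
have a0 z : 0 <= a z by rewrite le_max lexx orbT.
have b0 z : 0 <= b z by rewrite le_max lexx orbT.
have aM z : a z <= M.
  by rewrite ge_max M0 andbT; apply: le_trans (uM z); exact: ler_norm.
have bM z : b z <= M.
  by rewrite ge_max M0 andbT; apply: le_trans (uM z); rewrite -normrN; exact: ler_norm.
have aB z : ~ B z -> a z = 0 by move=> /uB uz; rewrite /a uz maxxx.
have bB z : ~ B z -> b z = 0 by move=> /uB uz; rewrite /b uz oppr0 maxxx.
have uE z : u z = a z - b z.
  by rewrite /a /b /Num.max oppr_lt0; case: ltgtP; lra.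
have ab z : a z * b z = 0.
  by rewrite /a /b /Num.max oppr_lt0; case: ltgtP => h;
    rewrite ?mul0r ?mulr0// ?h ?oppr0 ?mulr0.
have usE z : u z ^+ 2 = a z * a z + b z * b z.
  by rewrite uE sqrrB ab mul0rn subr0 !expr2.
pose c z := a z * a z; pose d z := b z * b z.
have [mc md] : measurable_fun setT c /\ measurable_fun setT d.
  by split; exact: measurable_funM.
have c0 z : 0 <= c z by rewrite mulr_ge0.
have d0 z : 0 <= d z by rewrite mulr_ge0.
have cM z : c z <= M * M by rewrite ler_pM.
have dM z : d z <= M * M by rewrite ler_pM.
have cB z : ~ B z -> c z = 0 by move=> /aB h; rewrite /c h mul0r.
have dB z : ~ B z -> d z = 0 by move=> /bB h; rewrite /d h mul0r.
pose v z := u z ^+ 2.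
have mu2 : measurable_fun setT v by exact: measurable_funX.
have u20 z : 0 <= v z by exact: sqr_ge0.
have [Jaa Jaa0 JaaE] := kform_fin ma ma a0 a0 aM aM aB aB.
have [Jbb Jbb0 JbbE] := kform_fin mb mb b0 b0 bM bM bB bB.
have [Jab Jab0 JabE] := kform_fin ma mb a0 b0 aM bM aB bB.
have [ka ka0 kaE] := integral_gap_fin ma a0 aM aB.
have [kb kb0 kbE] := integral_gap_fin mb b0 bM bB.
have [Dc Dc0 DcE] := integral_gap_fin mc c0 cM cB.
have [Dd Dd0 DdE] := integral_gap_fin md d0 dM dB.
have Ju : (kform v (cst 1%R) <= (Dc + Dd)%:E)%E.
  apply: (le_trans (kform_cst1_le mu2 u20)).
  rewrite EFinD -DcE -DdE -ge0_integralD//.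
  - rewrite le_eqVlt; apply/orP; left; apply/eqP; apply: eq_integral => z _.
    by rewrite -EFinD /v usE -mulrDl.
  - by move=> z _; rewrite lee_fin mulr_ge0// gap_expN2_ge0.
  - by apply/measurable_EFinP; apply: measurable_funM => //; exact: measurable_gapN2.
  - by move=> z _; rewrite lee_fin mulr_ge0// gap_expN2_ge0.
  - by apply/measurable_EFinP; apply: measurable_funM => //; exact: measurable_gapN2.
have [Su Su0 SuE] : exists2 y, 0 <= y & kform v (cst 1%R) = y%:E.
  apply: ge0_fin_real Ju; exact: kform_ge0.
pose W := (\int[nu]_p ((u p.1 - u p.2) ^+ 2 * ksq p)%:E)%E.
have mW : measurable_fun setT (fun p : C * C => ((u p.1 - u p.2) ^+ 2 * ksq p)%:E).
  apply/measurable_EFinP; apply: measurable_funM; last exact: measurable_ksq.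
  apply: measurable_funX; apply: measurable_funB; exact: measurableT_comp.
have W0 (p : C * C) : (0 <= ((u p.1 - u p.2) ^+ 2 * ksq p)%:E)%E.
  by rewrite lee_fin mulr_ge0 ?sqr_ge0// ksq_ge0.
(* (u(x) - u(y))^2 |K|^2 expanded with u = a - b and a b = 0, the negative
   terms being on the left. *)
have WE : (W + (kform a a + kform a a) + (kform b b + kform b b) =
    (kform v (cst 1%R) + kform (cst 1%R) v) +
    (kform a b + kform a b) + (kform b a + kform b a))%E.
  have m1 : measurable_fun setT (cst 1%R : C -> R) by exact: measurable_cst.
  have o1 (z : C) : 0 <= cst 1%R z :> R by [].
  rewrite /W /kform -!ge0_integralD//;
    do ?[by move=> p _; rewrite ?adde_ge0 ?kform_int_ge0
        |by exact: kform_meas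
        |by do ?apply: emeasurable_funD; first [exact: mW|exact: kform_meas]].
  apply: eq_integral => p _; rewrite -!EFinD; congr EFin.
  rewrite /= /v !uE; move: (ab p.1) (ab p.2) => h1 h2.
  have e1 : (a p.1 - b p.1) ^+ 2 = a p.1 ^+ 2 + b p.1 ^+ 2.
    by rewrite sqrrB h1 mul0rn subr0.
  have e2 : (a p.2 - b p.2) ^+ 2 = a p.2 ^+ 2 + b p.2 ^+ 2.
    by rewrite sqrrB h2 mul0rn subr0.
  rewrite (sqrrB (a p.1 - b p.1)) e1 e2; ring.
have mr (h : C -> R) : measurable_fun setT h -> measurable_fun setT (lin_stat r h).
  exact: measurable_lin_stat.
(* (A - B)^2 + 2 A B = A^2 + B^2 for the statistics A of a and B of b. *)
have EU : (\int[P]_X (lin_stat r u X ^+ 2)%:E +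
  (\int[P]_X (lin_stat r a X * lin_stat r b X)%:E +
   \int[P]_X (lin_stat r a X * lin_stat r b X)%:E) =
   \int[P]_X (lin_stat r a X * lin_stat r a X)%:E +
     \int[P]_X (lin_stat r b X * lin_stat r b X)%:E)%E.
  have r0 (f : C -> R) X : (forall z, 0 <= f z) -> 0 <= lin_stat r f X by move=> f0;
    exact: sumr_ge0.
  have mrM (f g : C -> R) : measurable_fun setT f -> measurable_fun setT g ->
      measurable_fun setT (fun X : Conf R => (lin_stat r f X * lin_stat r g X)%:E).
    by move=> mf mg; apply/measurable_EFinP; apply: measurable_funM; exact: mr.
  have mru : measurable_fun setT (fun X : Conf R => (lin_stat r u X ^+ 2)%:E).
    by apply/measurable_EFinP; apply: measurable_funX; exact: mr.
  rewrite -!ge0_integralD//;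
    do ?[by move=> X _; rewrite lee_fin sqr_ge0
        |by move=> X _; rewrite ?adde_ge0// lee_fin mulr_ge0 ?r0
        |by exact: mrM |by apply: emeasurable_funD; exact: mrM].
  apply: eq_integral => X _; rewrite -!EFinD; congr EFin.
  have -> : lin_stat r u X = lin_stat r a X - lin_stat r b X.
    by rewrite /lin_stat -sumrB; apply: eq_bigr => z _; exact: uE.
  ring.
move: EU; set EX := (\int[P]_X (lin_stat r u X ^+ 2)%:E)%E.
clearbody EX; rewrite !(expectation_lin_statM hP r1)//.
have subE (x : \bar R) (y t : R) : (x + y%:E = t%:E)%E -> x = (t - y)%:E.
  by case: x => //= x [<-]; rewrite addrK.
have Raa := integral_rho2_kform ma ma a0 a0 aB aB.
have Rbb := integral_rho2_kform mb mb b0 b0 bB bB.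
have Rab := integral_rho2_kform ma mb a0 b0 aB bB.
rewrite kaE JaaE -EFinM in Raa; rewrite kbE JbbE -EFinM in Rbb.
rewrite kaE kbE JabE -EFinM in Rab.
rewrite (subE _ _ _ Raa) (subE _ _ _ Rbb) (subE _ _ _ Rab) DcE DdE.
have -> : (\int[mu]_z (a z * b z * gap z ^- 2)%:E)%E = 0%E.
  by apply: integral0_eq => z _; rewrite ab mul0r.
rewrite add0e -!EFinD => EU.
move: WE; rewrite (kformC mb ma b0 a0) JaaE JbbE JabE.
rewrite (kformC (measurable_cst _) mu2 (fun=> ler01) u20) SuE -!EFinD -addeA -EFinD.
rewrite -/W => /subE ->; rewrite (subE _ _ _ EU) -EFinD lee_fin.
move: Ju; rewrite SuE lee_fin => Ju.
have := sqr_ge0 (ka - kb); rewrite sqrrB => h.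
by lra.
Qed.

End variance.

(** * The hyperbolic weight *)

Section weights.
Variables (R : realType) (z : R[i]).
Hypothesis dz : disk R z.
Local Notation C := R[i].

Definition pseudo_dist (x : C) : R := normc (moebius z x).

Lemma pseudo_dist_ge0 x : 0 <= pseudo_dist x. Proof. exact: normc_ge0. Qed.

Lemma pseudo_distE x : pseudo_dist x = normc (x - z) / normc (1 - x * z^*%C).
Proof. by rewrite /pseudo_dist /moebius normcM normcV (mulrC z^*%C). Qed.

Lemma pseudo_dist_sqr x : disk R x ->
  1 - pseudo_dist x ^+ 2 = gap x * gap z / kden x z.
Proof.
move=> dx; have k0 := kden_gt0 dx dz.
rewrite pseudo_distE exprMn exprVn -/(kden x z).
apply: (mulIf (lt0r_neq0 k0)); rewrite mulrBl !divfK ?gt_eqF// mul1r kdenE; ring.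
Qed.

Lemma pseudo_dist_lt1 x : disk R x -> pseudo_dist x < 1.
Proof.
move=> dx; rewrite -(@ltr_pXn2r _ 2) ?nnegrE ?pseudo_dist_ge0// expr1n.
have k0 := kden_gt0 dx dz.
by rewrite -subr_gt0 pseudo_dist_sqr// divr_gt0// mulr_gt0// gap_gt0.
Qed.

(** In terms of the pseudo-hyperbolic distance m, exp(-d) = (1 - m) / (1 + m)
    lies between (1 - m^2) / 4 and 1 - m^2. Since 1 - m^2 is, for fixed z,
    comparable to gap x, so is exp(-d): this is the content of the two bounds
    [expR_poincare_ge] and [expR_poincare_le]. *)
Lemma expR_poincare x : disk R x ->
  expR (- poincare_dist z x) = (1 - pseudo_dist x) / (1 + pseudo_dist x).
Proof.
move=> dx; have m0 := pseudo_dist_ge0 x; have m1 := pseudo_dist_lt1 dx.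
rewrite expRN /poincare_dist -/(pseudo_dist x) lnK ?invf_div//.
by rewrite posrE divr_gt0 ?subr_gt0 ?ltr_pwDl.
Qed.

Lemma poincare_dist_ge0 x : disk R x -> 0 <= poincare_dist z x.
Proof.
move=> dx; have m0 := pseudo_dist_ge0 x; have m1 := pseudo_dist_lt1 dx.
rewrite /poincare_dist -/(pseudo_dist x) ln_ge0// ler_pdivlMr ?subr_gt0// mul1r.
lra.
Qed.

Lemma kden_le4 x : disk R x -> kden x z <= 4.
Proof.
move=> dx; have -> : 4 = 2 ^+ 2 :> R by rewrite expr2 -natrM.
apply: lerXn2r; rewrite ?nnegrE ?normc_ge0//.
apply: (le_trans (le_normcD _ _)); rewrite normcN normc1 normcM normc_conj.
have -> : 2 = 1 + 1 * 1 :> R by rewrite mulr1.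
by rewrite lerD2l ler_pM ?normc_ge0// ltW// normc_lt1.
Qed.

Lemma kden_ge x : disk R x -> (1 - normc z) ^+ 2 <= kden x z.
Proof.
move=> dx; apply: lerXn2r; rewrite ?nnegrE ?normc_ge0 ?subr_ge0 ?(ltW (normc_lt1 dz))//.
rewrite lerBlDr -[leLHS]normc1 -[X in normc X <= _](subrK (x * z^*%C)).
apply: (le_trans (le_normcD _ _)); rewrite lerD2l normcM normc_conj.
by rewrite ler_piMl ?normc_ge0// ltW// normc_lt1.
Qed.

Lemma expR_poincare_ge x : disk R x ->
  gap z / 16 * gap x <= expR (- poincare_dist z x).
Proof.
move=> dx; rewrite expR_poincare//.
have m0 := pseudo_dist_ge0 x; have m1 := pseudo_dist_lt1 dx.
have k0 := kden_gt0 dx dz; have px := gap_gt0 dx; have pz := gap_gt0 dz.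
apply: (@le_trans _ _ ((1 - pseudo_dist x ^+ 2) / 4)).
  have -> : gap z / 16 * gap x = gap x * gap z * 16^-1 by ring.
  rewrite pseudo_dist_sqr// -(mulrA _ _ 4^-1) -invfM ler_wpM2l//.
    by rewrite mulr_ge0// ltW.
  rewrite lef_pV2 ?posrE//; last by rewrite mulr_gt0.
  have := kden_le4 dx; lra.
have -> : 1 - pseudo_dist x ^+ 2 = (1 - pseudo_dist x) * (1 + pseudo_dist x) by ring.
rewrite -mulrA ler_wpM2l ?subr_ge0 ?(ltW m1)//.
rewrite -[leRHS]mul1r ler_pdivlMr; last by lra.
rewrite mulrAC ler_pdivrMr// mul1r.
have : (1 + pseudo_dist x) <= 2 by lra.
nra.
Qed.

Lemma expR_poincare_le x : disk R x ->
  expR (- poincare_dist z x) <= gap x / (1 - normc z) ^+ 2.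
Proof.
move=> dx; rewrite expR_poincare//.
have m0 := pseudo_dist_ge0 x; have m1 := pseudo_dist_lt1 dx.
have k0 := kden_gt0 dx dz; have px := gap_gt0 dx; have pz := gap_gt0 dz.
have kz : 0 < (1 - normc z) ^+ 2 by rewrite exprn_gt0// subr_gt0 normc_lt1.
apply: (@le_trans _ _ (1 - pseudo_dist x ^+ 2)).
  have -> : 1 - pseudo_dist x ^+ 2 = (1 - pseudo_dist x) * (1 + pseudo_dist x) by ring.
  rewrite ler_wpM2l ?subr_ge0 ?(ltW m1)//.
  by rewrite (@le_trans _ _ 1)// ?invf_le1; lra.
rewrite pseudo_dist_sqr// -mulrA ler_wpM2l ?(ltW px)//.
rewrite ler_pdivrMr// mulrC ler_pdivlMr//.
apply: (@le_trans _ _ (1 * (1 - normc z) ^+ 2)); last by rewrite mul1r kden_ge.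
by rewrite ler_wpM2r ?(ltW kz)// /gap gerBl sqr_ge0.
Qed.

Lemma measurable_poincare : measurable_fun setT (fun x : C => poincare_dist z x).
Proof.
have mp : measurable_fun setT pseudo_dist.
  have -> : pseudo_dist = (fun x => normc (x - z) / normc (1 - x * z^*%C)).
    by apply/funext => x; exact: pseudo_distE.
  apply: measurable_funM.
    by apply: measurable_normc; apply: measurable_funCD.
  apply: measurable_funV; apply: measurable_normc; apply: measurable_funCD => //.
  by apply: measurable_funCN; apply: measurable_funCM.
have m1 : measurable_fun setT (fun x => 1 + pseudo_dist x).
  by apply: measurable_funD => //; exact: measurable_cst.
have m2 : measurable_fun setT (fun x => 1 - pseudo_dist x).
  by apply: measurable_funB => //; exact: measurable_cst.
exact: (measurableT_comp (@measurable_ln R) (measurable_funM m1 (measurable_funV m2))).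
Qed.

Variables (s : R) (N : nat).
Hypotheses (s1 : 1 < s) (s32 : s <= 3 / 2).

Definition hball : set C := [set x | disk R x /\ poincare_dist z x < N.+1%:R].

Lemma measurable_hball : measurable hball.
Proof.
have -> : hball = disk R `&` (fun x : C => poincare_dist z x) @^-1` `]-oo, N.+1%:R[.
  by apply/seteqP; split => x; rewrite /hball /= in_itv.
apply: measurableI; first exact: measurable_disk.
by rewrite -[X in measurable X]setTI; exact: measurable_poincare.
Qed.

(** The weight exp(-s d), cut off to the union of the annuli of index at most
    N. *)
Definition weight (x : C) : R := \1_hball x * expR (- s * poincare_dist z x).

Lemma measurable_weight : measurable_fun setT weight.
Proof.
apply: measurable_funM; first by apply: measurable_indic; exact: measurable_hball.
apply: measurableT_comp => //; apply: measurable_funM; first exact: measurable_cst.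
exact: measurable_poincare.
Qed.

Lemma weight_ge0 x : 0 <= weight x.
Proof. by rewrite mulr_ge0// expR_ge0. Qed.

Lemma weight_le1 x : weight x <= 1.
Proof.
rewrite /weight indicE; case: (boolP (x \in hball)); last by rewrite mul0r.
rewrite inE => -[dx _]; rewrite mul1r -expR0 ler_expR.
by rewrite mulNr oppr_le0 mulr_ge0// ?poincare_dist_ge0// ltW// (lt_trans ltr01 s1).
Qed.

(** This is where s <= 3/2 enters: exp(-2 s d) >= exp(-3 d). *)
Lemma weight_sqr_ge x : hball x -> (gap z / 16) ^+ 3 * gap x ^+ 3 <= weight x ^+ 2.
Proof.
move=> hx; have [dx _] := hx; rewrite /weight indicE mem_set// mul1r -exprMn.
apply: (@le_trans _ _ (expR (- poincare_dist z x) ^+ 3)).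
  apply: lerXn2r; rewrite ?nnegrE ?expR_ge0 ?expR_poincare_ge//.
  by rewrite !mulr_ge0// ltW// gap_gt0.
rewrite -!expRM_natl ler_expR.
have := mulr_ge0 (_ : 0 <= 3 / 2 - s) (poincare_dist_ge0 dx).
rewrite subr_ge0 => /(_ s32). lra.
Qed.

(** Chosen so that the hyperbolic ball lies in the Euclidean ball
    |x|^2 <= hball_radius, which is compact in the disk. *)
Definition hball_radius : R := 1 - (1 - normc z) ^+ 2 * expR (- N.+1%:R).

Lemma hball_radius_lt1 : hball_radius < 1.
Proof.
by rewrite gtrBl mulr_gt0// ?expR_gt0// exprn_gt0// subr_gt0 normc_lt1.
Qed.

Lemma hball_cball x : hball x -> sqn x <= hball_radius.
Proof.
move=> [dx dN]; have kz : 0 < (1 - normc z) ^+ 2 by rewrite exprn_gt0// subr_gt0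
  normc_lt1.
suff : (1 - normc z) ^+ 2 * expR (- N.+1%:R) <= gap x by rewrite /gap /hball_radius; lra.
rewrite mulrC -ler_pdivlMr//; apply: le_trans (expR_poincare_le dx).
by rewrite ler_expR lerN2 ltW.
Qed.

End weights.

(** * Testing on polynomials *)

(** Stated for a field over itself, whose normed module structure is, for the
    complex numbers, convertible to the one used by [holomorphic_on_disk]. *)
Lemma derivable_sum_expr (K : numFieldType) (M : nat) (c : nat -> K) (x : K) :
  derivable (fun y : K^o => \sum_(0 <= i < M) c i * y ^+ i : K^o) x 1.
Proof.
elim: M => [|M ih].
  rewrite (_ : (fun _ => _) = cst 0); first exact: derivable_cst.
  by apply/funext => y; rewrite big_geq.
rewrite (_ : (fun _ => _) = (fun y : K^o => \sum_(0 <= i < M) c i * y ^+ i : K^o) +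
    (cst (c M) : K^o -> K^o) * (@GRing.exp K ^~ M : K^o -> K^o)).
  apply: derivableD => //; apply: derivableM; first exact: derivable_cst.
  exact: exprn_derivable.
by apply/funext => y; rewrite big_nat_recr.
Qed.

Section supremum.
Variables (R : realType) (z : R[i]).
Hypothesis dz : disk R z.
Local Notation C := R[i].
Local Notation Re := (@complex.Re R).
Local Notation Im := (@complex.Im R).
Variables (s : R) (N : nat).
Local Notation rN := (hball_radius z N).
Local Notation w := (weight z s N).
Let r1 : rN < 1 := hball_radius_lt1 dz N.

(** At most one of the intervals [k, k + 1) contains d. *)
Lemma sum_steps (V : zmodType) (n : nat) (d : R) (c : V) : 0 <= d ->
  \sum_(0 <= k < n) (if k%:R <= d < k.+1%:R then c else 0) =
  if d < n%:R then c else 0.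
Proof.
move=> d0; elim: n => [|n ih]; first by rewrite big_geq// ltNge d0.
rewrite big_nat_recr//= ih; case: (ltP d n%:R) => dn.
  by rewrite /= addr0 (lt_trans dn)// ltr_nat.
by rewrite add0r.
Qed.

Lemma sum_weighted_sum (X : Conf R) (f : C -> C) :
  \sum_(0 <= k < N.+1) weighted_sum X k s z f =
  \sum_(x <- points_in rN X) (w x)%:C * f x.
Proof.
have fin := finite_points_cball r1 X.
transitivity (\sum_(0 <= k < N.+1) \sum_(x <- points_in rN X)
    if k%:R <= poincare_dist z x < k.+1%:R
    then (expR (- s * poincare_dist z x))%:C * f x else 0).
  apply: eq_big_nat => k /andP[_ kN]; rewrite /weighted_sum.
  have -> : points X `&` annulus k z = (points X `&` cball rN) `&` annulus k z.
    apply/seteqP; split => [x [Xx [dx kx]]|x [[Xx _] kx]]; split => //.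
    split => //; apply: hball_cball => //; split => //.
    by case/andP: kx => _ /lt_le_trans; apply; rewrite ler_nat.
  rewrite fsbig_mkcondr fsbig_finite//= -/(points_in rN X).
  rewrite big_seq [RHS]big_seq; apply: eq_bigr => x.
  rewrite in_points_in// inE => -[_ Bx].
  have dx := cball_subdisk r1 Bx.
  case: ifPn => [|kx]; first by rewrite inE => -[_ ->].
  by case: ifPn => // kx'; case/negP: kx; rewrite inE; split.
rewrite exchange_big /= big_seq [RHS]big_seq; apply: eq_bigr => x.
rewrite in_points_in// inE => -[_ Bx]; have dx := cball_subdisk r1 Bx.
rewrite sum_steps ?poincare_dist_ge0// /weight indicE.
case: ifPn => dN; first by rewrite mem_set ?mul1r.
by rewrite memNset ?mul0r ?mul0r// => -[_]; apply/negP.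
Qed.

Definition power_sum (X : Conf R) (n : nat) : C :=
  \sum_(x <- points_in rN X) (w x)%:C * x ^+ n.

Lemma holomorphic_cpoly M (c : nat -> C) : holomorphic_on_disk (cpoly M c).
Proof.
by move=> x _; exact: (@derivable_sum_expr C M c x).
Qed.

Lemma bergman_sqnorm_cpoly M (c : nat -> C) :
  bergman_sqnorm (cpoly M c) = (\sum_(0 <= i < M) normc (c i) ^+ 2 / i.+1%:R)%:E.
Proof.
rewrite /bergman_sqnorm integral_disk_area; first exact: integral_cpoly_sqr.
  exact: measurable_cpoly_sqr.
by move=> y; rewrite lee_fin sqr_ge0.
Qed.

(** The functional L f = sum_x w(x) f(x) is tested on l times the polynomial
    with coefficients (n + 1) conj(L z^n), its Riesz representative among
    polynomials of degree below M. Let T be the left-hand side. This polynomial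
    has squared norm l^2 T, and L takes the value l T on it, so l = T^(-1/2) is
    the right scaling (with l = 0 if T = 0). *)
Lemma sup_ge_power_sums (X : Conf R) (M : nat) :
  ((\sum_(0 <= n < M) n.+1%:R * normc (power_sum X n) ^+ 2)%:E <=
   ereal_sup [set ((normc (\sum_(0 <= k < N.+1) weighted_sum X k s z f)) ^+ 2)%:E
     | f in [set f : C -> C | bergman_space f /\ (bergman_norm f <= 1)%R]])%E.
Proof.
set T := \sum_(0 <= n < M) _.
have T0 : 0 <= T by apply: sumr_ge0 => n _; rewrite mulr_ge0// sqr_ge0.
pose l := (Num.sqrt T)^-1.
have lT : l ^+ 2 * T <= 1.
  rewrite /l exprVn sqr_sqrtr//; have [->|T1] := eqVneq T 0; first by rewrite mulr0.
  by rewrite mulVf.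
have lT2 : l ^+ 2 * T ^+ 2 = T.
  rewrite /l exprVn sqr_sqrtr//; have [->|T1] := eqVneq T 0;
    first by rewrite expr0n mulr0.
  by rewrite expr2 mulKf.
pose c n : C := l%:C * (n.+1%:R * (power_sum X n)^*%C).
have norm_f : bergman_sqnorm (cpoly M c) = (l ^+ 2 * T)%:E.
  rewrite bergman_sqnorm_cpoly; congr EFin; rewrite /T mulr_sumr.
  apply: eq_bigr => n _; rewrite /c !normcM normc_nat normc_conj.
  have -> : normc l%:C = l by rewrite /= expr0n addr0 sqrtr_sqr ger0_norm// invr_ge0
    sqrtr_ge0.
  rewrite !exprMn (expr2 n.+1%:R) !mulrA; apply: (canLR (mulfK _));
    first by rewrite pnatr_eq0.
  ring.
apply: ereal_sup_ubound => /=; exists (cpoly M c).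
  split; first split.
  - exact: holomorphic_cpoly.
  - by rewrite norm_f ltry.
  - by rewrite /bergman_norm norm_f /= -sqrtr1 ler_sqrt.
congr EFin; rewrite sum_weighted_sum.
have -> : \sum_(x <- points_in rN X) (w x)%:C * cpoly M c x = (l * T)%:C.
  transitivity (\sum_(0 <= n < M) c n * power_sum X n).
    rewrite /cpoly; under eq_bigr do rewrite mulr_sumr.
    rewrite exchange_big /=; apply: eq_bigr => n _; rewrite mulr_sumr.
    by apply: eq_bigr => x _; ring.
  rewrite /T mulr_sumr rmorph_sum; apply: eq_bigr => n _.
  rewrite (rmorphM _ l) (rmorphM _ n.+1%:R) /= rmorph_nat.
  rewrite /c normc_sqr; case: (power_sum X n) => a b /=; rewrite -!mulrA.
  congr (_ * (_ * _)); simpc; congr (_ +i* _); ring.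
by rewrite /= expr0n addr0 sqrtr_sqr real_normK ?num_real// exprMn.
Qed.

Lemma normc_power_sum (X : Conf R) n : normc (power_sum X n) ^+ 2 =
  lin_stat rN (fun x => w x * Re (x ^+ n)) X ^+ 2 + lin_stat rN (fun x =>
    w x * Im (x ^+ n)) X ^+ 2.
Proof.
rewrite normc_sqr /power_sum Re_sum Im_sum /lin_stat; congr (_ ^+ 2 + _ ^+ 2).
  by apply: eq_bigr => x _; case: (x ^+ n) => a b /=; ring.
by apply: eq_bigr => x _; case: (x ^+ n) => a b /=; ring.
Qed.

End supremum.

(** * The distance between weighted kernels *)

Section local_energy.
Variable R : realType.
Local Notation C := R[i].
Local Notation Re := (@complex.Re R).
Local Notation Im := (@complex.Im R).
Local Notation mu := (@disk_area R).

(** As M grows, this tends to the squared norm of a K_x - b K_y in A^2. *)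
Definition energy_sum (a b : R) (x y : C) (M : nat) : R :=
  \sum_(0 <= n < M) n.+1%:R * normc (a%:C * x ^+ n - b%:C * y ^+ n) ^+ 2.

Lemma energy_sumE a b x y M : energy_sum a b x y M =
  a ^+ 2 * kernel_sum M (sqn x) + b ^+ 2 * kernel_sum M (sqn y)
  - a * b * Re (kernel_sum M (x * y^*%C)) *+ 2.
Proof.
rewrite /energy_sum /kernel_sum Re_sum !mulr_sumr -sumrMnl -big_split -sumrB /=.
apply: eq_bigr => n _; rewrite [(x * _) ^+ n]exprMn -(rmorphXn (@conjc R)) /=.
have sX (u : C) : sqn u ^+ n = normc (u ^+ n) ^+ 2.
  by rewrite /sqn normcX -!exprM mulnC.
rewrite !sX.
have -> c : Re (n.+1%:R * c) = n.+1%:R * Re c.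
  by rewrite -(rmorph_nat (real_complex R)); case: c => e f /=; ring.
rewrite !normc_sqr; case: (x ^+ n) (y ^+ n) => e f [g h] /=; ring.
Qed.

Lemma cvg_kernel_sum_real (t : R) : 0 <= t < 1 ->
  (fun M => kernel_sum M t) @ \oo --> (1 - t) ^- 2.
Proof.
move=> /andP[t0 t1].
have := @cvg_kernel_sum R t%:C; rewrite /= expr0n addr0 sqrtr_sqr ger0_norm// => /(_ t1).
move/cvg_Re; under eq_fun do rewrite kernel_sum_real /=.
by rewrite -(rmorph1 (real_complex R)) -rmorphB -rmorphXn -fmorphV.
Qed.

(** The bound is the squared distance of a K_x to the line spanned by K_y. Once
    Re K(x, y) is replaced by |K(x, y)|, what is left over is a perfect square. *)
Lemma energy_sum_lim_ge a b x y : disk R x -> disk R y -> 0 <= a -> 0 <= b ->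
  exists2 l, energy_sum a b x y @ \oo --> l &
    a ^+ 2 * (gap x ^- 2 - gap y ^+ 2 * kden x y ^- 2) <= l.
Proof.
move=> dx dy a0 b0; have [[px py] kxy] := (gap_gt0 dx, gap_gt0 dy, kden_gt0 dx dy).
exists (a ^+ 2 * gap x ^- 2 +
  b ^+ 2 * gap y ^- 2 - a * b * Re ((1 - x * y^*%C) ^- 2) *+ 2).
  rewrite (_ : energy_sum a b x y = fun M => a ^+ 2 * kernel_sum M (sqn x) +
    b ^+ 2 * kernel_sum M (sqn y) - a * b * Re (kernel_sum M (x * y^*%C)) *+ 2);
      last first.
    by apply/funext => M; exact: energy_sumE.
  have sq (u : C) : disk R u -> 0 <= sqn u < 1 by move=> /diskE; rewrite sqr_ge0.
  apply: cvgB; first apply: cvgD.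
  - by apply: cvgM; [exact: cvg_cst|apply: cvg_kernel_sum_real; exact: sq].
  - by apply: cvgM; [exact: cvg_cst|apply: cvg_kernel_sum_real; exact: sq].
  apply: cvgMn; apply: cvgM; first exact: cvg_cst.
  by apply: cvg_Re; apply: cvg_kernel_sum; exact: normc_disk_mul.
have ReD : Re ((1 - x * y^*%C) ^- 2) <= (kden x y)^-1.
  apply: (le_trans (ler_norm _)); apply: (le_trans (ler_Re_normc _)).
  by rewrite normcV normcX.
have h : a * b * Re ((1 - x * y^*%C) ^- 2) <= a * b * (kden x y)^-1.
  by rewrite ler_wpM2l// mulr_ge0.
have : 0 <= (b / gap y - a * gap y / kden x y) ^+ 2 by exact: sqr_ge0.
have -> : (b / gap y - a * gap y / kden x y) ^+ 2 =
   b ^+ 2 * gap y ^- 2 - (a * b / kden x y) *+ 2 + a ^+ 2 * (gap y ^+ 2 * kden x y ^- 2).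
  by field; rewrite !gt_eqF.
rewrite mulrBr; lra.
Qed.

(** For given x, the points y of a square of side comparable to gap x, at a
    distance comparable to gap x from x. They are far enough for K_x and K_y to
    be well separated in direction, and close enough for |K(x, y)| to be
    comparable to K(x, x). *)
Definition near_square : set (C * C) := [set p |
  [/\ gap p.1 / 8 <= Re p.2 - Re p.1 <= gap p.1 / 4 &
      gap p.1 / 8 <= Im p.2 - Im p.1 <= gap p.1 / 4] ].

Lemma near_squareP x y : disk R x -> near_square (x, y) ->
  [/\ disk R y, kden x y <= 3 * gap x ^+ 2 & gap x ^+ 2 / 32 <= normc (x - y) ^+ 2].
Proof.
move=> dx [/= /andP[a1 a2] /andP[b1 b2]]; have px := gap_gt0 dx.
set dl := gap x in px a1 a2 b1 b2 *.
have eE : normc (x - y) ^+ 2 = (Re y - Re x) ^+ 2 + (Im y - Im x) ^+ 2.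
  by rewrite normc_sqr; case: x y {dx dl px a1 a2 b1 b2} => a b [c d] /=; ring.
have e1 : dl ^+ 2 / 32 <= normc (x - y) ^+ 2 by rewrite eE; nra.
have e2 : normc (x - y) ^+ 2 <= dl ^+ 2 / 8 by rewrite eE; nra.
have n0 := normc_ge0 (x - y).
(* 36 / 100 exceeds 1 / sqrt 8, and stays below the bound 1 / 2 needed for y
   to remain in the disk. *)
have e3 : normc (x - y) <= 36 / 100 * dl.
  rewrite -(@ler_pXn2r _ 2) ?nnegrE//; last by rewrite mulr_ge0// ?ltW.
  by apply: (le_trans e2); nra.
have x1 := normc_lt1 dx; have x0 := normc_ge0 x; have y0 := normc_ge0 y.
have dlE : dl = (1 - normc x) * (1 + normc x) by rewrite /dl /gap /sqn; ring.
have xd : normc x <= 1 - dl / 2 by nra.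
have yx : normc y <= normc x + normc (x - y).
  rewrite -(normcN (x - y)) opprB; apply: le_trans (le_normcD _ _).
  by rewrite addrC subrK.
have xy : normc x <= normc y + normc (x - y).
  by apply: le_trans (le_normcD _ _); rewrite addrC subrK.
have y1 : normc y < 1 by lra.
have dy : disk R y by rewrite /disk /= norm_normc ltcR.
have qd : gap y <= 2 * dl.
  have -> : gap y = dl + (normc x - normc y) * (normc x + normc y).
    by rewrite /dl /gap /sqn; ring.
  have h1 : normc x - normc y <= 36 / 100 * dl by lra.
  have h2 : (normc x - normc y) * (normc x + normc y) <= 36 / 100 * dl * (normc x +
    normc y).
    by rewrite ler_wpM2r// addr_ge0.
  have h3 : 36 / 100 * dl * (normc x + normc y) <= 36 / 100 * dl * 2.
    by rewrite ler_wpM2l//; [rewrite mulr_ge0// ltW|lra].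
  lra.
split => //; rewrite kdenE -/dl.
have := ler_wpM2l (ltW px) qd; rewrite (mulrCA dl) -expr2; lra.
Qed.

(** With p, q for the gaps of x and y, k for [kden] and e for |x - y|^2, the
    right-hand side is (k^2 - (p q)^2) / (p^2 k^4). Since k = p q + e, the
    numerator is at least e^2, while e >= p^2 / 32 and k <= 3 p^2. *)
Lemma local_energy_ge x y : disk R x -> near_square (x, y) ->
  (32 ^+ 2 * 9 ^+ 2 * gap x ^+ 6)^-1 <=
  (gap x ^- 2 - gap y ^+ 2 * kden x y ^- 2) * kden x y ^- 2.
Proof.
move=> dx /(near_squareP dx)[dy k3 e1].
have [[px py] kxy] := (gap_gt0 dx, gap_gt0 dy, kden_gt0 dx dy).
have e0 : 0 <= normc (x - y) ^+ 2 by exact: sqr_ge0.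
have kE := kdenE x y.
set p := gap x in px k3 e1 kE *; set q := gap y in py kE *.
set e := normc (x - y) ^+ 2 in e0 e1 kE; set k := kden x y in kxy k3 kE *.
have k2 : k ^- 2 >= (9 * p ^+ 4)^-1.
  have kk : 0 < k ^+ 2 by exact: exprn_gt0.
  have p4 : 0 < 9 * p ^+ 4 by rewrite mulr_gt0// exprn_gt0.
  rewrite lef_pV2 ?posrE//.
  have -> : 9 * p ^+ 4 = (3 * p ^+ 2) ^+ 2 by ring.
  by apply: lerXn2r => //; rewrite nnegrE ltW// mulr_gt0// exprn_gt0.
have -> : p ^- 2 - q ^+ 2 * k ^- 2 = (k ^+ 2 - (p * q) ^+ 2) * (p ^- 2 * k ^- 2).
  by field; rewrite !gt_eqF.
have h1 : (p ^+ 2 / 32) ^+ 2 <= k ^+ 2 - (p * q) ^+ 2.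
  apply: (@le_trans _ _ (e ^+ 2)).
    by apply: lerXn2r => //; rewrite nnegrE mulr_ge0// exprn_ge0// ltW.
  have pq0 : 0 <= p * q by rewrite mulr_ge0// ltW.
  by rewrite kE; nra.
have -> : (32 ^+ 2 * 9 ^+ 2 * p ^+ 6)^-1 =
  (p ^+ 2 / 32) ^+ 2 * (p ^- 2 * (9 * p ^+ 4)^-1) * (9 * p ^+ 4)^-1.
  by field; rewrite gt_eqF.
have g0 : 0 <= (9 * p ^+ 4)^-1 by rewrite invr_ge0 mulr_ge0// exprn_ge0// ltW.
have p2 : 0 <= p ^- 2 by rewrite invr_ge0 exprn_ge0// ltW.
have p32 : 0 <= (p ^+ 2 / 32) ^+ 2 by exact: sqr_ge0.
have pp : 0 <= p ^- 2 * (9 * p ^+ 4)^-1 by rewrite mulr_ge0.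
apply: ler_pM => //; first by rewrite mulr_ge0.
by apply: ler_pM => //; rewrite ler_wpM2l.
Qed.

Lemma measurable_near_square : measurable near_square.
Proof.
have md : measurable_fun setT (fun p : C * C => gap p.1).
  apply: measurable_funB => //; apply: measurableT_comp => //; exact: measurable_sqn.
have mI (f g h : C * C -> R) : measurable_fun setT f -> measurable_fun setT g ->
    measurable_fun setT h -> measurable [set p | f p <= g p <= h p].
  move=> mf mg mh.
  have -> : [set p | f p <= g p <= h p] =
     ((fun p => g p - f p) @^-1` `[0, +oo[) `&` ((fun p => h p - g p) @^-1` `[0, +oo[).
    apply/seteqP; split => p; rewrite /= !in_itv /= !andbT !subr_ge0.
      by move=> /andP[].
    by move=> [-> ->].
  have m1 := measurable_funB mg mf; have m2 := measurable_funB mh mg.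
  by apply: measurableI; rewrite -[X in measurable X]setTI; [exact: m1|exact: m2].
have -> : near_square =
  [set p | gap p.1 / 8 <= Re p.2 - Re p.1 <= gap p.1 / 4] `&`
  [set p | gap p.1 / 8 <= Im p.2 - Im p.1 <= gap p.1 / 4].
  by apply/seteqP; split => p [].
have mR (f : C -> R) : measurable_fun setT f ->
    measurable_fun setT (fun p : C * C => f p.2 - f p.1).
  by move=> mf; apply: measurable_funB; exact: measurableT_comp.
have mc c : measurable_fun setT (fun p : C * C => gap p.1 / c).
  by apply: measurable_funM => //; exact: measurable_cst.
by apply: measurableI; apply: mI => //; apply: mR;
  [exact: measurable_Re|exact: measurable_Im].
Qed.

Lemma area_rectangle (a b c e : R) : a < b -> c < e ->
  area R [set z | a <= Re z <= b /\ c <= Im z <= e] = (pi^-1 * ((b - a) * (e - c)))%:E.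
Proof.
move=> ab ce; rewrite /area /mscale /= /planar_lebesgue /pushforward.
rewrite EFinM; congr (_ * _)%E.
transitivity ((lebesgue_measure \x lebesgue_measure)%E
   (`[a, b]%classic `*` `[c, e]%classic : set (measurableTypeR R * measurableTypeR R))).
  by congr product_measure1; apply/seteqP; split => -[x y]; rewrite /= !in_itv.
rewrite product_measure1E//= !lebesgue_measure_itv /= !lte_fin ab ce.
by rewrite EFinM !EFinB.
Qed.

Lemma disk_area_near_square x : disk R x ->
  mu [set y | near_square (x, y)] = (pi^-1 * (gap x / 8) ^+ 2)%:E.
Proof.
move=> dx; have px := gap_gt0 dx; rewrite /disk_area /mrestr.
transitivity (area R [set z | Re x + gap x / 8 <= Re z <= Re x + gap x / 4 /\
   Im x + gap x / 8 <= Im z <= Im x + gap x / 4]).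
  congr (area R _); apply/seteqP; split => [y [[/= h1 h2] _]|y [h1 h2]] /=.
    by rewrite !lerBrDl !lerBlDl in h1 h2.
  have nxy : near_square (x, y) by split; rewrite /= !lerBrDl !lerBlDl.
  by split => //; have [] := near_squareP dx nxy.
rewrite area_rectangle; [|lra|lra].
by congr EFin; congr (_ * _); field.
Qed.

End local_energy.

(** * The mean energy *)

Section energy.
Variables (R : realType) (P : probability (Conf R) R).
Hypothesis hP : determinantal (@bergman_kernel R) P.
Variables (z : R[i]) (s : R).
Hypotheses (dz : disk R z) (s1 : 1 < s) (s32 : s <= 3 / 2).
Variable N : nat.
Local Notation C := R[i].
Local Notation Re := (@complex.Re R).
Local Notation Im := (@complex.Im R).
Local Notation mu := (@disk_area R).
Local Notation nu := (mu \x mu)%E.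
Local Notation w := (weight z s N).
Local Notation rN := (hball_radius z N).

Definition mean_sup : \bar R := (\int[P]_X ereal_sup
  [set ((normc (\sum_(0 <= k < N.+1) weighted_sum X k s z f)) ^+ 2)%:E
  | f in [set f : C -> C | bergman_space f /\ (bergman_norm f <= 1)%R]])%E.

Lemma weight_notin_cball x : ~ cball rN x -> w x = 0.
Proof.
move=> nx; rewrite /weight indicE memNset ?mul0r// => hx.
by apply: nx; exact: hball_cball.
Qed.

(** The second moment bound is applied to the real and imaginary parts of
    w(x) x^n, and the results are added with the weights n + 1. *)
Lemma energy_integral_le M :
  (\int[nu]_p (energy_sum (w p.1) (w p.2) p.1 p.2 M * ksq p)%:E <= mean_sup + mean_sup)%E.
Proof.
pose u n x := w x * Re (x ^+ n); pose v n x := w x * Im (x ^+ n).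
have mw : measurable_fun setT w := measurable_weight z s N.
have mX n : measurable_fun setT (fun x : C => x ^+ n) by exact: measurable_funCX.
have muv n : measurable_fun setT (u n) /\ measurable_fun setT (v n).
  by split; apply: measurable_funM => //;
    [exact: measurable_fun_Re|exact: measurable_fun_Im].
have r1 := hball_radius_lt1 dz N.
have wle (x : C) (t : R) n : `|t| <= normc (x ^+ n) -> `|w x * t| <= 1.
  have [Bx|/weight_notin_cball ->] := pselect (cball rN x); last by rewrite mul0r normr0.
  move=> tx; rewrite normrM (ger0_norm (weight_ge0 _ _ _ _)) -[leRHS]mulr1.
  rewrite ler_pM ?weight_ge0 ?weight_le1//; apply: (le_trans tx).
  by rewrite normcX exprn_ile1 ?normc_ge0// ltW// normc_lt1//;
    exact: cball_subdisk r1 _ Bx.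
have u1 n x : `|u n x| <= 1 by apply: (wle _ _ n); exact: ler_Re_normc.
have v1 n x : `|v n x| <= 1 by apply: (wle _ _ n); exact: ler_Im_normc.
have u0 n x : ~ cball rN x -> u n x = 0 by move=> /weight_notin_cball h;
  rewrite /u h mul0r.
have v0 n x : ~ cball rN x -> v n x = 0 by move=> /weight_notin_cball h;
  rewrite /v h mul0r.
pose A (f : C -> R) := (\int[P]_X (lin_stat rN f X ^+ 2)%:E)%E.
have A0 f : (0 <= A f)%E by apply: integral_ge0 => X _; rewrite lee_fin sqr_ge0.
have mr (f : C -> R) : measurable_fun setT f ->
  measurable_fun setT (fun X : Conf R => (lin_stat rN f X ^+ 2)%:E).
  by move=> mf; apply/measurable_EFinP; apply: measurable_funX;
    exact: measurable_lin_stat.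
have sumA : (\sum_(0 <= n < M) n.+1%:R%:E * (A (u n) + A (v n)) <= mean_sup)%E.
  apply: (@le_trans _ _ (\int[P]_X (\sum_(0 <= n < M)
      n.+1%:R%:E * ((lin_stat rN (u n) X ^+ 2)%:E + (lin_stat rN (v n) X ^+ 2)%:E)))%E).
    rewrite le_eqVlt; apply/orP; left; apply/eqP.
    rewrite ge0_integral_sum//; last 2 first.
    - move=> n; apply: emeasurable_funM => //.
      by apply: emeasurable_funD; apply: mr; case: (muv n).
    - by move=> n X _; rewrite mule_ge0 ?lee_fin// addr_ge0 ?sqr_ge0.
    apply: eq_bigr => n _; rewrite ge0_integralZl//.
    - congr (_ * _)%E; rewrite ge0_integralD//.
      + by move=> X _; rewrite lee_fin sqr_ge0.
      + by apply: mr; case: (muv n).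
      + by move=> X _; rewrite lee_fin sqr_ge0.
      + by apply: mr; case: (muv n).
    - by apply: emeasurable_funD; apply: mr; case: (muv n).
    - by move=> X _; rewrite lee_fin addr_ge0 ?sqr_ge0.
  apply: le_integral_of_le => X.
    by apply: sume_ge0 => n _; rewrite mule_ge0 ?lee_fin// addr_ge0 ?sqr_ge0.
  apply: le_trans (sup_ge_power_sums dz s N X M); rewrite -sumEFin.
  by apply: lee_sum => n _; rewrite normc_power_sum.
apply: le_trans (leeD sumA sumA); rewrite -big_split /=.
pose W (f : C -> R) := (\int[nu]_p ((f p.1 - f p.2) ^+ 2 * ksq p)%:E)%E.
have mW (f : C -> R) : measurable_fun setT f ->
    measurable_fun setT (fun p : C * C => ((f p.1 - f p.2) ^+ 2 * ksq p)%:E).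
  move=> mf; apply/measurable_EFinP; apply: measurable_funM; last exact: measurable_ksq.
  by apply: measurable_funX; apply: measurable_funB; exact: measurableT_comp.
have W0 (f : C -> R) (p : C * C) : (0 <= ((f p.1 - f p.2) ^+ 2 * ksq p)%:E)%E.
  by rewrite lee_fin mulr_ge0 ?sqr_ge0// ksq_ge0.
have WA (f : C -> R) : measurable_fun setT f -> (forall x, `|f x| <= 1) ->
    (forall x, ~ cball rN x -> f x = 0) -> (W f <= A f + A f)%E.
  by move=> mf f1 fB; exact: (variance_lower_bound hP r1 mf f1 fB).
apply: (@le_trans _ _ (\sum_(0 <= n < M) n.+1%:R%:E * (W (u n) + W (v n)))%E); last first.
  have AA n : (0 <= A (u n) + A (v n))%E by exact: adde_ge0.
  apply: lee_sum => n _; rewrite -ge0_muleDr//.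
  have [mu_n mv_n] := muv n.
  rewrite lee_wpmul2l ?lee_fin//;
    apply: le_trans (leeD (WA _ mu_n (u1 n) (u0 n)) (WA _ mv_n (v1 n) (v0 n))) _.
  by rewrite addeACA.
rewrite le_eqVlt; apply/orP; left; apply/eqP.
transitivity (\int[nu]_p (\sum_(0 <= n < M) n.+1%:R%:E *
    (((u n p.1 - u n p.2) ^+ 2 * ksq p)%:E + ((v n p.1 - v n p.2) ^+ 2 * ksq p)%:E)))%E.
  apply: eq_integral => p _; rewrite /energy_sum mulr_suml -sumEFin.
  apply: eq_bigr => n _; rewrite -EFinD -EFinM; congr EFin; rewrite -mulrDl mulrA.
  congr (_ * _ * _); rewrite normc_sqr /u /v;
    case: (p.1 ^+ n) (p.2 ^+ n) => a b [c e] /=; ring.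
rewrite ge0_integral_sum//; last 2 first.
- move=> n; apply: emeasurable_funM => //.
  by apply: emeasurable_funD; apply: mW; case: (muv n).
- move=> n p _; apply: mule_ge0; first by rewrite lee_fin.
  by apply: adde_ge0; exact: W0.
apply: eq_bigr => n _; rewrite ge0_integralZl//.
- congr (_ * _)%E; rewrite ge0_integralD//.
  + by apply: mW; case: (muv n).
  + by apply: mW; case: (muv n).
- by apply: emeasurable_funD; apply: mW; case: (muv n).
- by move=> p _; apply: adde_ge0; exact: W0.
Qed.

(** The product of the constants of [weight_sqr_ge] and [local_energy_ge]. *)
Definition energy_const : R := (gap z / 16) ^+ 3 / (32 ^+ 2 * 9 ^+ 2).

Lemma energy_const_gt0 : 0 < energy_const.
Proof. by rewrite divr_gt0 ?exprn_gt0 ?divr_gt0 ?gap_gt0. Qed.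

(** What is left of the energy density when only the y near x are kept and the
    weight is replaced by its lower bound. *)
Definition energy_minorant (p : C * C) : R :=
  \1_(@near_square R) p * (energy_const * (\1_(hball z N) p.1 * gap p.1 ^- 3)).

Lemma hball_gap_ge0 x j : 0 <= \1_(hball z N) x * gap x ^- j :> R.
Proof.
rewrite indicE; case: (boolP (x \in hball z N)); last by rewrite mul0r.
by rewrite inE => -[dx _]; rewrite mul1r invr_ge0 exprn_ge0// ltW// gap_gt0.
Qed.

Lemma energy_minorant_ge0 p : 0 <= energy_minorant p.
Proof.
have c0 := ltW energy_const_gt0.
by rewrite mulr_ge0// mulr_ge0// hball_gap_ge0.
Qed.

Lemma measurable_hball_gap j : measurable_fun setT (fun x : C =>
  \1_(hball z N) x * gap x ^- j : R).
Proof.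
apply: measurable_funM; first by apply: measurable_indic; exact: measurable_hball.
apply: measurable_funV; apply: measurable_funX.
by apply: measurable_funB => //; exact: measurable_sqn.
Qed.

Lemma measurable_energy_minorant : measurable_fun setT energy_minorant.
Proof.
apply: measurable_funM; first by apply: measurable_indic; exact: measurable_near_square.
apply: measurable_funM; first exact: measurable_cst.
exact: (measurableT_comp (measurable_hball_gap 3)).
Qed.

Lemma energy_sum_ge0 a b x y M : 0 <= energy_sum a b x y M :> R.
Proof. by apply: sumr_ge0 => n _; rewrite mulr_ge0// sqr_ge0. Qed.

Lemma energy_minorant_le p : ((energy_minorant p)%:E <=
  limn_einf (fun M => (energy_sum (w p.1) (w p.2) p.1 p.2 M * ksq p)%:E))%E.
Proof.
have f0 M : (0 <= (energy_sum (w p.1) (w p.2) p.1 p.2 M * ksq p)%:E)%E.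
  by rewrite lee_fin mulr_ge0 ?energy_sum_ge0 ?ksq_ge0.
rewrite /energy_minorant indicE; case: (boolP (p \in _)) => /= [|_]; last first.
  by rewrite mul0r; exact: limn_einf_ge0.
rewrite inE => np; rewrite indicE; case: (boolP (p.1 \in _)) => /= [|_]; last first.
  by rewrite mul0r !mulr0; exact: limn_einf_ge0.
rewrite inE => hx; case: p => x y /= in f0 np hx *.
have dx := hx.1; have [dy _ _] := near_squareP dx np.
have [l ll lge] := energy_sum_lim_ge dx dy (weight_ge0 z s N x) (weight_ge0 z s N y).
have fl : (fun M => (energy_sum (w x) (w y) x y M * ksq (x,
  y))%:E) @ \oo --> (l * ksq (x, y))%:E.
  by apply: cvg_EFin; [exact: nearW|apply: cvgM => //; exact: cvg_cst].
have [-> _] := cvg_limn_einf_sup fl; rewrite lee_fin !mul1r.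
apply: (@le_trans _ _ (w x ^+ 2 * (32 ^+ 2 * 9 ^+ 2 * gap x ^+ 6)^-1)).
  have px := gap_gt0 dx.
  have -> : energy_const * gap x ^- 3 =
     (gap z / 16) ^+ 3 * gap x ^+ 3 * (32 ^+ 2 * 9 ^+ 2 * gap x ^+ 6)^-1.
    by rewrite /energy_const; field; rewrite gt_eqF.
  rewrite ler_wpM2r ?weight_sqr_ge//.
  by rewrite invr_ge0 mulr_ge0// exprn_ge0// ltW.
apply: (@le_trans _ _ (w x ^+ 2 * ((gap x ^- 2 - gap y ^+ 2 * kden x y ^- 2) * kden x y
  ^- 2))).
  by rewrite ler_wpM2l ?sqr_ge0// local_energy_ge.
by rewrite mulrA ler_wpM2r// (ksq_ge0 (x, y)).
Qed.

Lemma energy_minorant_integral_le :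
  (\int[nu]_p (energy_minorant p)%:E <= mean_sup + mean_sup)%E.
Proof.
apply: (@fatou_bound _ _ _ _
  (fun M p => (energy_sum (w p.1) (w p.2) p.1 p.2 M * ksq p)%:E)).
- move=> M; apply/measurable_EFinP; apply: measurable_funM; last exact: measurable_ksq.
  apply: measurable_sum => n; apply: measurable_funM; first exact: measurable_cst.
  have mwX (f : C * C -> C) : measurable_fun setT f ->
      measurable_fun setT (fun p => (w (f p))%:C * f p ^+ n).
    move=> mf; apply: measurable_funCM; last exact: measurable_funCX.
    apply: measurable_complexP => /=; last exact: measurable_cst.
    by apply: measurableT_comp mf; exact: measurable_weight.
  apply: measurable_funX; apply: measurable_normc; apply: measurable_funCD.
    exact: (mwX fst).
  apply: measurable_funCN; exact: (mwX snd).
- by move=> M p; rewrite lee_fin mulr_ge0 ?energy_sum_ge0 ?ksq_ge0.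
- exact: energy_integral_le.
- by move=> p; rewrite lee_fin energy_minorant_ge0.
- exact: energy_minorant_le.
Qed.

(** Integrating over the square of area (gap x / 8)^2 / pi turns (gap x)^-3
    into a multiple of (gap x)^-1. *)
Lemma integral_energy_minorant :
  ((energy_const / (64 * pi))%:E * \int[mu]_x (\1_(hball z N) x * gap x ^- 1)%:E <=
   \int[nu]_p (energy_minorant p)%:E)%E.
Proof.
have c0 := energy_const_gt0; have pi0 := pi_gt0 R.
have cp : 0 <= energy_const / (64 * pi) by rewrite divr_ge0 ?(ltW c0)// mulr_ge0// ltW.
have mG : measurable_fun setT (fun p => (energy_minorant p)%:E).
  by apply/measurable_EFinP; exact: measurable_energy_minorant.
have G0 p : (0 <= (energy_minorant p)%:E)%E by rewrite lee_fin energy_minorant_ge0.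
rewrite fubini_tonelli1// -ge0_integralZl//; last 2 first.
- by apply/measurable_EFinP; exact: (measurable_hball_gap 1).
- by move=> x _; rewrite lee_fin (hball_gap_ge0 _ 1).
apply: le_integral_disk.
- by apply/measurable_EFinP; apply: measurable_funM;
    [exact: measurable_cst|exact: (measurable_hball_gap 1)].
- exact: measurable_fun_fubini_tonelli_F.
- by move=> x; rewrite -EFinM lee_fin mulr_ge0 ?(hball_gap_ge0 _ 1).
- by move=> x; apply: integral_ge0 => y _.
move=> x dx; have px := gap_gt0 dx.
pose c := energy_const * (\1_(hball z N) x * gap x ^- 3).
have cc0 : 0 <= c by rewrite mulr_ge0 ?hball_gap_ge0// ltW.
have mA : measurable [set y | near_square (x, y)].
  have -> : [set y | near_square (x, y)] = xsection (@near_square R) x.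
    by apply/seteqP; split => y; rewrite /xsection /= inE.
  by apply: measurable_xsection; exact: measurable_near_square.
rewrite /fubini_F (eq_integral (fun y =>
  c%:E * (\1_[set y | near_square (x, y)] y)%:E)%E); last first.
  by move=> y _; rewrite -EFinM mulrC.
rewrite ge0_integralZl//; last by apply/measurable_EFinP; exact: measurable_indic.
rewrite integral_indic// setIT [X in (_ <= _ * X)%E](disk_area_near_square dx).
rewrite -!EFinM lee_fin le_eqVlt.
apply/orP; left; apply/eqP; rewrite /c expr1.
rewrite invfM; move: (pi^-1) => q; field; exact: lt0r_neq0.
Qed.

End energy.

(** * Divergence *)

Section divergence.
Variables (R : realType).
Local Notation C := R[i].
Local Notation mu := (@disk_area R).

Lemma sum_sqn_le M (x : C) : disk R x -> \sum_(0 <= n < M) sqn x ^+ n <= (gap x)^-1.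
Proof.
move=> dx; have px := gap_gt0 dx.
rewrite -[leRHS]mul1r ler_pdivlMr// mulrC /gap.
have -> : (1 - sqn x) * \sum_(0 <= n < M) sqn x ^+ n = 1 - sqn x ^+ M.
  by rewrite -opprB mulNr big_mkord -subrX1 opprB.
by rewrite gerBl exprn_ge0// sqr_ge0.
Qed.

(** 1 / (1 - |x|^2) dominates the sums of |x|^(2 n), whose means are 1 / (n + 1). *)
Lemma harmonic_le_integral (g : C -> R) (M : nat) : measurable_fun setT g ->
  (forall x, 0 <= g x) -> (forall x, disk R x -> (gap x)^-1 <= g x) ->
  ((series harmonic M : R)%:E <= \int[mu]_x (g x)%:E)%E.
Proof.
move=> mg g0 dg.
have sq0 n (x : C) : 0 <= sqn x ^+ n by rewrite exprn_ge0// sqr_ge0.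
have msq n : measurable_fun setT (fun x : C => (sqn x ^+ n)%:E).
  by apply/measurable_EFinP; apply: measurable_funX; exact: measurable_sqn.
apply: (@le_trans _ _ (\int[mu]_x (\sum_(0 <= n < M) (sqn x ^+ n)%:E))%E).
  rewrite ge0_integral_sum//; last by move=> n x _; rewrite lee_fin.
  rewrite /series /= -sumEFin le_eqVlt; apply/orP; left; apply/eqP.
  by apply: eq_bigr => n _; rewrite integral_disk_sqn.
apply: le_integral_disk.
- by apply: emeasurable_sum.
- exact/measurable_EFinP.
- by move=> x; apply: sume_ge0 => n _; rewrite lee_fin.
- by move=> x; rewrite lee_fin.
move=> x dx; rewrite sumEFin lee_fin; apply: le_trans (dg x dx).
exact: sum_sqn_le.
Qed.

End divergence.

Theorem proposition1p13 (R : realType) (P : probability (Conf R) R)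
    (hP : determinantal (@bergman_kernel R) P)
    (s : R) (hs1 : 1 < s) (hs2 : s <= 3 / 2) (z : R[i]) (hz : disk R z) :
  ereal_sup [set (\int[P]_X ereal_sup
      [set ((normc (\sum_(0 <= k < N.+1) weighted_sum X k s z f)) ^+ 2)%:E
        | f in [set f : R[i] -> R[i] | bergman_space f /\ (bergman_norm f <= 1)%R]])%E
    | N in [set: nat]] = +oo%E.
Proof.
pose mu := @disk_area R.
apply/eqP; rewrite -leye_eq leNgt; apply/negP.
set S := ereal_sup _ => Sfin.
have ES N : (mean_sup P z s N <= S)%E by apply: ereal_sup_ubound; exists N.
pose k := energy_const z / (64 * pi).
have k0 : 0 < k by rewrite divr_gt0 ?energy_const_gt0// mulr_gt0// pi_gt0.
have fE N : (k%:E * \int[mu]_x (\1_(hball z N) x * gap x ^- 1)%:E <= S + S)%E.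
  apply: le_trans (leeD (ES N) (ES N)).
  apply: le_trans (integral_energy_minorant hz N) _.
  exact: energy_minorant_integral_le.
have S0 : (0 <= S + S)%E.
  apply: le_trans (fE 0%N); rewrite mule_ge0 ?lee_fin ?(ltW k0)//.
  by apply: integral_ge0 => x _; rewrite lee_fin (hball_gap_ge0 _ _ _ 1).
have [c SE] : exists c, (S + S = c%:E)%E.
  have : (S + S < +oo)%E by exact: lte_add_pinfty.
  by case: (S + S)%E S0 => // c _ _; exists c.
pose g (x : R[i]) : R := \1_(disk R) x * gap x ^- 1.
have g0 x : 0 <= g x.
  rewrite /g indicE; case: (boolP (x \in disk R)); last by rewrite mul0r.
  by rewrite inE mul1r expr1 => dx; rewrite invr_ge0 ltW// gap_gt0.
have mg : measurable_fun setT g.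
  apply: measurable_funM; first by apply: measurable_indic; exact: measurable_disk.
  apply: measurable_funV; apply: measurable_funX.
  by apply: measurable_funB => //; exact: measurable_sqn.
(* If S were finite, letting N grow would bound the integral of 1 / gap. *)
have gc : (\int[mu]_x (g x)%:E <= (c / k)%:E)%E.
  apply: (@fatou_bound _ _ _ _
    (fun N x => (\1_(hball z N) x * gap x ^- 1)%:E)).
  - by move=> N; apply/measurable_EFinP; exact: measurable_hball_gap.
  - by move=> N x; rewrite lee_fin (hball_gap_ge0 _ _ _ 1).
  - move=> N; move: (fE N); rewrite SE.
    by rewrite (mulrC c) [X in _ -> (_ <= X)%E]EFinM lee_pdivlMl.
  - by move=> x; rewrite lee_fin.
  - move=> x; rewrite /g indicE; case: (boolP (x \in disk R)) => /= [|_]; last first.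
      rewrite mul0r; apply: limn_einf_ge0 => N.
      by rewrite lee_fin (hball_gap_ge0 _ _ _ 1).
    rewrite inE => dx; rewrite mul1r.
    suff fx : (fun N => (\1_(hball z N) x * gap x ^- 1)%:E) @ \oo --> (gap x ^- 1)%:E.
      by have [-> _] := cvg_limn_einf_sup fx.
    (* x lies in the ball as soon as N exceeds its distance to z. *)
    apply: cvg_near_cst; exists (Num.truncn (poincare_dist z x)) => // N /= dN.
    rewrite indicE mem_set ?mul1r//; split => //.
    apply: lt_le_trans (truncnS_gt _) _.
    by rewrite ler_nat ltnS.
apply: (@dvg_harmonic R); apply: nondecreasing_is_cvgn.
  by apply: nondecreasing_series => n _ _; exact: harmonic_ge0.
exists (c / k) => _ [M _ <-]; rewrite -lee_fin; apply: le_trans gc.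
apply: harmonic_le_integral => // x dx.
by rewrite /g indicE mem_set// mul1r expr1.
Qed.
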